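(* Let $(W,S)$ be a Coxeter system with $W$ finite, with longest element $w_S$, and let $(\hat W,\hat S)$, $z_I$ ($I\subseteq S$), $V$, $d$, the action of $\mathbf W=W\times W$ on $V$, $\tilde b_{w,v}$, $c_{w,v}$, $c^{\mathrm{inv}}_{w,v}$ be as defined in the context. Define a map $\varphi'\colon V\to\hat W$ by $\varphi'([I,a,b])=az_Ib^{-1}w_S$. Then: (i) The map $\varphi'$ restricts to an order isomorphism from $V$ to the interval $[w_Sz_\emptyset w_S,1]$ of $\hat W$ in reverse Chevalley-Bruhat order. (ii) $\ell(\varphi'(v))=-d(v)+|S|+\ell(w_S)$ for $v\in V$. (iii) $\varphi'((a,b).v)=a\,\varphi'(v)\,w_Sb^{-1}w_S$ for $v\in V$ and $(a,b)\in\mathbf W$. (iv) $\tilde b_{w,v}=\tilde R_{\varphi'(v),\varphi'(w)}$ for $v,w\in V$. (v) $c_{w,v}=Q_{\varphi'(v),\varphi'(w)}$ and $c^{\mathrm{inv}}_{w,v}=P_{\varphi'(v),\varphi'(w)}$ for $v,w\in V$, where $P_{x,y}$ and $Q_{x,y}$ are the Kazhdan-Lusztig polynomials and inverse Kazhdan-Lusztig polynomials of $(\hat W,\hat S)$.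
   Context: Coxeter notation. For a Coxeter system, $\ell$ is the length function and $\leq_\emptyset$ the Chevalley-Bruhat order. For $I\subseteq S$, $W_I$ is the standard parabolic subgroup generated by $I$, and $W^I=\{x\in W\mid x\leq_\emptyset xs\text{ for all }s\in I\}$ is the set of minimal left coset representatives of $W_I$ in $W$. Ring. $\mathcal R=\mathbb Z[u,u^{-1}]$, with ring involution $a\mapsto\bar a$, $\bar u=u^{-1}$; $\alpha=u-u^{-1}$, so $\bar\alpha=-\alpha$. ''Semi-linear'' means with respect to this involution. The poset $V$. $V=\{[I,a,b]\mid I\subseteq S,\ a\in W^I,\ b\in W\}$ (set of triples). Define $[I,a_1,b_1]\leq_1[J,a_2,b_2]$ if $I\subseteq J$, $a_2\leq_\emptyset a_1$, $b_1\leq_\emptyset b_2$; define $[I,a_1,b_1]\leq_2[J,a_2,b_2]$ if $I\subseteq J$ and $b_1=b_2c$ for some $c\in W_J$ with $\ell(b_1)=\ell(b_2)+\ell(c)$ and $a_2c\leq_\emptyset a_1$. The partial order $\leq$ on $V$ is the one generated by $\leq_1$ and $\leq_2$ ($v\leq w$ iff there is a finite chain from $v$ to $w$ each step of which is $\leq_1$ or $\leq_2$). The dimension function is $d([I,a,b])=-\ell(a)+\ell(b)+|I|$. Action on $V$. Let $\mathbf W=W\times W$, $\mathbf S=(S\times\{1\})\cup(\{1\}\times S)$. $\mathbf W$ acts on the left on $V$ by: $(1,s).[I,a,b]=[I,a,sb]$; $(s,1).[I,a,b]=[I,sa,b]$ if $sa\in W^I$; and $(s,1).[I,a,b]=[I,a,bt]$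 if $a\leq_\emptyset sa$ and $sa=at$ with $t\in I$ (for $s\in S$; exactly one of the last two cases occurs). The polynomials $\tilde b_{w,v}$. $\mathbf H$ is the Iwahori-Hecke algebra of $(\mathbf W,\mathbf S)$: free over $\mathcal R$ on $\tilde T_x$ ($x\in\mathbf W$) with, for $\mathbf s\in\mathbf S$, $\tilde T_{\mathbf s}\tilde T_x=\tilde T_{\mathbf sx}$ if $x\leq_\emptyset\mathbf sx$ and $\tilde T_{\mathbf s}\tilde T_x=\tilde T_{\mathbf sx}+\alpha\tilde T_x$ otherwise. $\mathcal M$ is the free $\mathcal R$-module on $\{\tilde m_v\mid v\in V\}$, an $\mathbf H$-module via $\tilde T_{\mathbf s}.\tilde m_v=\tilde m_{\mathbf s.v}$ if $d(v)<d(\mathbf s.v)$ and $\tilde T_{\mathbf s}.\tilde m_v=\tilde m_{\mathbf s.v}+\alpha\tilde m_v$ if $d(\mathbf s.v)<d(v)$. $\tilde{\mathcal M}$ is the completion of $\mathcal M$ consisting of formal $\mathcal R$-linear combinations of the $\tilde m_v$. For elements $a,b$ of a Coxeter group, $\tilde R_{a,b}(u)=(-u)^{-\ell(b)+\ell(a)}R_{a,b}(u^2)$ where $R_{a,b}$ are the Kazhdan-Lusztig $R$-polynomials ($R_{a,b}=0$ unless $a\leq_\emptyset b$). Springer's map $\Delta\colon\mathcal M\to\tilde{\mathcal M}$ is the semi-linear map $\Delta(\tilde m_v)=\sum_{w\in V}\tilde b_{w,v}\tilde m_w$ ($\tilde b_{w,v}\in\mathcal R$) uniquely determined by: (a) $\Delta(\tilde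 T_{\mathbf s}.m)=\tilde T_{\mathbf s}^{-1}.\Delta(m)$ for $\mathbf s\in\mathbf S$, $m\in\mathcal M$; (b) $\tilde b_{[I,a_1,b_1],[J,a_2,1]}=0$ if $I\not\subseteq J$ or $b_1\notin W_J$, and $=(\bar\alpha)^{|J|-|I|}\tilde R_{a_2b_1,a_1}$ otherwise. Kazhdan-Lusztig polynomials for $V$. $c_{w,v}\in\mathbb Z[q]$ ($w,v\in V$) are the polynomials with $c_{w,v}=0$ unless $w\leq v$ such that, setting $\gamma_{w,v}=u^{d(w)-d(v)}c_{w,v}(u^2)$, one has $\gamma_{v,v}=1$, $\gamma_{w,v}\in u^{-1}\mathbb Z[u^{-1}]$ for $w<v$, and $\gamma_{w,v}=\sum_{w\leq z\leq v}\tilde b_{w,z}\overline{\gamma_{z,v}}$. The inverse polynomials $c^{\mathrm{inv}}_{w,v}$ (zero unless $w\leq v$) are determined by $\sum_{w\leq z\leq v}(-1)^{d(z)-d(w)}c_{w,z}\,c^{\mathrm{inv}}_{z,v}=\delta_{w,v}$. The group $\hat W$. $(\hat W,\hat S)$ is a fixed Coxeter system such that $S\subseteq\hat S$, $W=\hat W_S$ is the standard parabolic subgroup of $\hat W$ generated by $S$, and there is a bijection $\theta\colon S\to\hat S\smallsetminus S$ such that for $r,s\in S$, $r$ and $\theta(s)$ do not commute in $\hat W$ iff $r=s$. Fix an enumeration $S=\{r_1,\dots,r_n\}$ with distinct $r_i$. For $I\subseteq S$ put $z_I=\theta(r_{i_1})\cdots\theta(r_{i_m})\in\hat W$ where $S\smallsetminus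 I=\{r_{i_1},\dots,r_{i_m}\}$ with $i_1<\cdots<i_m$. Inverse Kazhdan-Lusztig polynomials of $\hat W$: $Q_{x,y}$ is determined by $\sum_{x\leq_\emptyset z\leq_\emptyset y}(-1)^{\ell(z)-\ell(x)}P_{x,z}Q_{z,y}=\delta_{x,y}$; $P_{x,y}=Q_{x,y}=0$ unless $x\leq_\emptyset y$. In reverse Chevalley-Bruhat order $1$ is the maximum element of $\hat W$, and the interval $[w_Sz_\emptyset w_S,1]$ is $\{x\in\hat W\mid x\leq_\emptyset w_Sz_\emptyset w_S\}$ with the reverse of $\leq_\emptyset$. *)

(* Defs.v *)
From HB Require Import structures.
From Stdlib Require Import Relation_Operators.
From mathcomp Require Import all_boot all_order all_algebra all_fingroup.
From mathcomp Require Import boolp classical_sets fsbigop.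

Set Implicit Arguments.
Unset Strict Implicit.
Unset Printing Implicit Defensive.

Import GRing.Theory Num.Theory.

Local Open Scope ring_scope.

Local Notation "x %:F" := (FracField.tofrac x).

(* The ring Z[u, u^-1] is realised as the subring of Q(u) of all x such that  *)
(* x * u ^+ n is a polynomial for some n.                                     *)

Definition ufrac : {fraction {poly int}} := ('X : {poly int})%:F.

Definition laurent_pred : {pred {fraction {poly int}}} :=
  fun x => `[< exists p : {poly int}, exists n : nat, x * ufrac ^+ n = p%:F >].

Lemma laurent_subring : subring_closed laurent_pred.
Proof.
split=> [|x y /asboolP[p [n xE]] /asboolP[q [m yE]]
         |x y /asboolP[p [n xE]] /asboolP[q [m yE]]]; apply/asboolP.
- by exists 1, 0%N; rewrite expr0 mulr1 tofrac1.
- exists (p * 'X^m - q * 'X^n), (n + m)%N.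
  rewrite tofracB !tofracM !tofracXn -xE -yE exprD mulrBl.
  by congr (_ - _); rewrite ?mulrA // mulrAC -!mulrA.
- by exists (p * q), (n + m)%N; rewrite tofracM -xE -yE exprD mulrACA.
Qed.

Record laurent := Laurent {
  laurent_val :> {fraction {poly int}};
  laurent_valP : laurent_val \in laurent_pred }.

HB.instance Definition _ := [isSub for laurent_val].
HB.instance Definition _ := [Choice of laurent by <:].
HB.instance Definition _ :=
  GRing.SubChoice_isSubComNzRing.Build _ _ laurent laurent_subring.

Definition laurent_unit : {pred laurent} := fun x => `[< exists y, y * x = 1 >].

Definition laurent_inv (x : laurent) : laurent :=
  if pselect (exists y, y * x = 1) is left e then sval (cid e) else x.

Lemma laurent_mulVx : {in laurent_unit, left_inverse 1 laurent_inv *%R}.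
Proof.
by move=> x /asboolP ux; rewrite /laurent_inv; case: pselect => // e; case: cid.
Qed.

Lemma laurent_unitPl (x y : laurent) : y * x = 1 -> laurent_unit x.
Proof. by move=> yx; apply/asboolP; exists y. Qed.

Lemma laurent_inv_out : {in [predC laurent_unit], laurent_inv =1 id}.
Proof.
move=> x; rewrite inE /= => /asboolPn nux; rewrite /laurent_inv.
by case: pselect.
Qed.

HB.instance Definition _ := GRing.ComNzRing_hasMulInverse.Build laurent
  laurent_mulVx laurent_unitPl laurent_inv_out.

Lemma laurent_integral : GRing.integral_domain_axiom laurent.
Proof.
move=> x y /(congr1 val)/eqP; rewrite rmorphM rmorph0 mulf_eq0.
by rewrite -!(inj_eq val_inj) rmorph0.
Qed.

HB.instance Definition _ :=
  GRing.ComUnitRing_isIntegral.Build laurent laurent_integral.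

Lemma u_subproof : ufrac \in laurent_pred.
Proof. by apply/asboolP; exists 'X, 0%N; rewrite expr0 mulr1. Qed.

Definition u : laurent := Laurent u_subproof.

Definition alpha : laurent := u - u^-1.

Definition peval (x : laurent) (p : {poly int}) : laurent :=
  (map_poly intr p).[x].

Lemma laurent_num (x : laurent) :
  exists pn : {poly int} * nat, val x * ufrac ^+ pn.2 = pn.1%:F.
Proof. by case: x => x /= /asboolP[p [n xE]]; exists (p, n). Qed.

(* If x = p(u) * u ^- n, then bar x = p(u ^-1) * u ^+ n; lemma barE shows     *)
(* that the choice of (p, n) is irrelevant.                                   *)
Definition bar (x : laurent) : laurent :=
  let: (p, n) := sval (cid (laurent_num x)) in peval u^-1 p * u ^+ n.

Lemma u_unit : u \is a GRing.unit.
Proof.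
have u0 : ufrac != 0 by rewrite tofrac_eq0 polyX_eq0.
have uV : ufrac^-1 \in laurent_pred.
  by apply/asboolP; exists 1, 1%N; rewrite expr1 mulVf // tofrac1.
by apply: (@laurent_unitPl _ (Laurent uV)); apply: val_inj; apply: mulVf.
Qed.

Lemma peval_is_monoid_morphism x : monoid_morphism (peval x).
Proof.
by split=> [|p q]; rewrite /peval ?rmorph1 ?hornerC // rmorphM hornerM.
Qed.

Lemma peval_is_zmod_morphism x : zmod_morphism (peval x).
Proof. by move=> p q; rewrite /peval rmorphB !hornerE. Qed.

HB.instance Definition _ x := GRing.isZmodMorphism.Build {poly int} laurent
  (peval x) (peval_is_zmod_morphism x).
HB.instance Definition _ x := GRing.isMonoidMorphism.Build {poly int} laurent
  (peval x) (peval_is_monoid_morphism x).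

Lemma pevalM p q x : peval x (p * q) = peval x p * peval x q.
Proof. exact: (rmorphM (peval x)). Qed.

Lemma pevalD p q x : peval x (p + q) = peval x p + peval x q.
Proof. exact: (rmorphD (peval x)). Qed.

Lemma pevalB p q x : peval x (p - q) = peval x p - peval x q.
Proof. exact: (rmorphB (peval x)). Qed.

Lemma pevalX x : peval x 'X = x.
Proof. by rewrite /peval map_polyX hornerX. Qed.

Lemma pevalXn n x : peval x 'X^n = x ^+ n.
Proof. by rewrite /peval map_polyXn hornerXn. Qed.

Lemma pevalC (c : int) x : peval x c%:P = c%:~R.
Proof. by rewrite /peval map_polyC hornerC. Qed.

Lemma peval_u (p : {poly int}) : val (peval u p) = p%:F.
Proof.
elim/poly_ind: p => [|p c IHp]; first by rewrite (rmorph0 (peval u)) tofrac0.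
rewrite pevalD pevalM pevalX pevalC tofracD tofracM -IHp.
rewrite rmorphD rmorphM rmorph_int; congr (_ + _).
by rewrite -[c in RHS]intz !rmorph_int.
Qed.

Lemma peval_u_inj : injective (peval u).
Proof.
by move=> p q /(congr1 val); rewrite !peval_u => /eqP; rewrite tofrac_eq => /eqP.
Qed.

Lemma barE (x : laurent) (p : {poly int}) (n : nat) :
  x * u ^+ n = peval u p -> bar x = peval u^-1 p * u ^+ n.
Proof.
move=> xE; rewrite /bar; case: cid => -[q m] /= xF.
have {}xF : x * u ^+ m = peval u q.
  by apply: val_inj; rewrite peval_u -xF rmorphM rmorphXn.
have : p * 'X^m = q * 'X^n.
  by apply: peval_u_inj; rewrite !pevalM !pevalXn -xE -xF mulrAC.
move/(congr1 (peval u^-1)); rewrite !pevalM !pevalXn !exprVn => pq.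
have ux k : u ^+ k \is a GRing.unit by rewrite unitrX ?u_unit.
apply: (@mulIr _ (u ^- m * u ^- n)); first by rewrite unitrM !unitrV !ux.
rewrite [LHS]mulrA mulrK ?ux // [u ^- m * _]mulrC.
by rewrite [RHS]mulrA mulrK ?ux.
Qed.

Lemma laurentP (x : laurent) :
  exists p : {poly int}, exists n : nat, x * u ^+ n = peval u p.
Proof.
have [[p n] xE] := laurent_num x; exists p, n.
by apply: val_inj; rewrite peval_u -xE rmorphM rmorphXn.
Qed.

Lemma bar_is_zmod_morphism : zmod_morphism bar.
Proof.
move=> x y; have [p [n xE]] := laurentP x; have [q [m yE]] := laurentP y.
rewrite (barE xE) (barE yE) (@barE _ (p * 'X^m - q * 'X^n) (n + m)).
  rewrite pevalB !pevalM !pevalXn mulrBl exprD !exprVn.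
  have ux k : u ^+ k \is a GRing.unit by rewrite unitrX ?u_unit.
  rewrite -!mulrA; congr (_ * _ - _ * _); last by rewrite mulKr ?ux.
  by rewrite mulrCA mulVr ?ux ?mulr1.
rewrite pevalB !pevalM !pevalXn -xE -yE exprD mulrBl !mulrA.
by congr (_ - _); rewrite mulrAC.
Qed.

Lemma bar_is_monoid_morphism : monoid_morphism bar.
Proof.
split=> [|x y]; first by rewrite (@barE _ 1 0) ?rmorph1 ?mulr1.
have [p [n xE]] := laurentP x; have [q [m yE]] := laurentP y.
rewrite (barE xE) (barE yE) (@barE _ (p * q) (n + m)).
  by rewrite pevalM exprD mulrACA.
by rewrite pevalM -xE -yE exprD mulrACA.
Qed.

HB.instance Definition _ :=
  GRing.isZmodMorphism.Build laurent laurent bar bar_is_zmod_morphism.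
HB.instance Definition _ :=
  GRing.isMonoidMorphism.Build laurent laurent bar bar_is_monoid_morphism.

Lemma bar_u : bar u = u^-1.
Proof. by rewrite (@barE _ 'X 0) ?pevalX ?mulr1. Qed.

Lemma barK : involutive bar.
Proof.
move=> x; have [p [n xE]] := laurentP x.
have bE (q : {poly int}) : bar (peval u^-1 q) = peval u q.
  elim/poly_ind: q => [|q c IHq]; first by rewrite !rmorph0.
  by rewrite !rmorphD !rmorphM /= IHq !pevalX !pevalC rmorphV ?u_unit //=
    bar_u invrK rmorph_int.
rewrite (barE xE) rmorphM rmorphXn /= bE bar_u -xE exprVn mulrK //.
by rewrite unitrX ?u_unit.
Qed.

Section Coxeter.

Variables (G : groupType) (S : {pred G}).

(* G has the presentation < S | (s t)^m(s,t) = 1 >, m(s,t) being the order of *)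
(* s t in G, stated as a universal property.                                  *)
Record coxeter_system : Prop := CoxeterSystem {
  cox_neq1 : forall s, s \in S -> s != 1%g;
  cox_invol : forall s, s \in S -> (s * s = 1)%g;
  cox_generate : forall x : G,
    exists w : seq G, all [in S] w /\ x = (\prod_(s <- w) s)%g;
  cox_universal : forall (H : groupType) (f : G -> H),
    (forall s t n, s \in S -> t \in S ->
       ((s * t) ^+ n = 1)%g -> ((f s * f t) ^+ n = 1)%g) ->
    exists g : G -> H,
      {morph g : x y / (x * y)%g} /\ {in S, g =1 f} }.

Definition has_word (x : G) (n : nat) : bool :=
  `[< exists w : seq G,
      [/\ all [in S] w, size w = n & x = (\prod_(s <- w) s)%g] >].

(* The value 0 on elements outside the subgroup generated by S is junk. *)
Definition cox_length (x : G) : nat :=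
  if pselect (exists n, has_word x n) is left e then ex_minn e else 0%N.

Definition reduced (w : seq G) : Prop :=
  all [in S] w /\ cox_length (\prod_(s <- w) s)%g = size w.

Definition reflection (t : G) : Prop := exists s g, s \in S /\ t = (s ^ g)%g.

Inductive bruhat (x : G) : G -> Prop :=
  | bruhat_refl : bruhat x x
  | bruhat_step y t : bruhat x y -> reflection t ->
      (cox_length y < cox_length (y * t)%g)%N -> bruhat x (y * t)%g.

Definition bruhat_interval (x y : G) : set G :=
  [set z | bruhat x z /\ bruhat z y]%classic.

End Coxeter.

(* Let the free module with basis (m_x), x in X, carry the operator           *)
(*   T m_x = m_(sigma x)              if ~~ desc x,                           *)
(*   T m_x = m_(sigma x) + alpha m_x  if desc x,                              *)
(* where sigma is an involution.  A formal linear combination is represented  *)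
(* by its coefficient function f : X -> laurent, and Tact is T in these terms *)
(* (the coefficient of m_x in T f comes from m_(sigma x) and m_x only).       *)
Definition Tact (X : Type) (sigma : X -> X) (desc : X -> bool)
    (f : X -> laurent) : X -> laurent :=
  fun x => f (sigma x) + (if desc x then alpha * f x else 0).

(* T_s ^2 = 1 + alpha T_s in the Hecke algebra, so T_s ^-1 = T_s - alpha. *)
Definition Tinv (X : Type) (sigma : X -> X) (desc : X -> bool)
    (f : X -> laurent) : X -> laurent :=
  fun x => Tact sigma desc f x - alpha * f x.

Section KazhdanLusztig.

Variables (G : groupType) (S : {pred G}).

Local Notation l := (cox_length S).

(* Left multiplication by T_s ^-1 on the Hecke algebra, in the basis (T_x). *)
Definition hecke_Tinv (s : G) : (G -> laurent) -> (G -> laurent) :=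
  Tinv (fun x => s * x)%g (fun x => ~~ `[< bruhat S x (s * x)%g >]).

(* For w a reduced word of y, this is T_(y ^-1) ^-1, the image of T_y under   *)
(* the bar involution of the Hecke algebra.                                   *)
Definition hecke_bar (w : seq G) : G -> laurent :=
  foldr hecke_Tinv (fun x => (x == 1%g)%:R) w.

(* q ^ ((l x - l y) / 2) * F_(x,y)(q), with q = u ^ 2 *)
Definition klnorm (F : G -> G -> {poly int}) (x y : G) : laurent :=
  u ^ ((l x)%:Z - (l y)%:Z) * peval (u ^+ 2) (F x y).

(* Kazhdan and Lusztig's definition, in the normalised basis: the image of    *)
(* T_y under bar is the sum over x of bar (klnorm R x y) T_x.                 *)
Definition is_R_polynomials (R : G -> G -> {poly int}) : Prop :=
  forall (w : seq G) (x : G), reduced S w ->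
    hecke_bar w x = bar (klnorm R x (\prod_(s <- w) s)%g).

Definition Rtilde (R : G -> G -> {poly int}) (x y : G) : laurent :=
  (- u) ^ ((l x)%:Z - (l y)%:Z) * peval (u ^+ 2) (R x y).

(* klP_bar: the sum over x of klnorm P x y * T_x is fixed by the bar          *)
(* involution of the Hecke algebra.                                           *)
Record is_KL_polynomials (R P : G -> G -> {poly int}) : Prop := IsKL {
  klP_le : forall x y, ~ bruhat S x y -> P x y = 0;
  klP_diag : forall y, P y y = 1;
  klP_deg : forall x y, bruhat S x y -> x != y ->
    (((size (P x y)).-1).*2 < l y - l x)%N;
  klP_bar : forall x y, klnorm P x y =
    \sum_(z \in bruhat_interval S x y) bar (klnorm P z y) * bar (klnorm R x z) }.

Record is_inverse_KL_polynomials (P Q : G -> G -> {poly int}) : Prop :=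
  IsInverseKL {
  klQ_le : forall x y, ~ bruhat S x y -> Q x y = 0;
  klQ_inv : forall x y,
    \sum_(z \in bruhat_interval S x y)
      (-1) ^+ (l z - l x)%N * (P x z * Q z y) = (x == y)%:R }.

End KazhdanLusztig.

Section Poset.

Variables (W : finGroupType) (S : {set W}).

Local Notation l := (cox_length S).

Definition min_reps (I : {set W}) : {set W} :=
  [set a | `[< forall s, s \in I -> bruhat S a (a * s)%g >]].

Record V := MkV {
  Vtriple : {set W} * W * W;
  VtripleP : (Vtriple.1.1 \subset S) && (Vtriple.1.2 \in min_reps Vtriple.1.1) }.

HB.instance Definition _ := [isSub for Vtriple].
HB.instance Definition _ := [Finite of V by <:].

Definition vI (v : V) : {set W} := (Vtriple v).1.1.
Definition va (v : V) : W := (Vtriple v).1.2.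
Definition vb (v : V) : W := (Vtriple v).2.

Definition Vle1 (v w : V) : Prop :=
  [/\ vI v \subset vI w, bruhat S (va w) (va v) & bruhat S (vb v) (vb w)].

Definition Vle2 (v w : V) : Prop :=
  vI v \subset vI w /\
  exists c, [/\ c \in <<vI w>>%g, vb v = (vb w * c)%g,
    l (vb v) = (l (vb w) + l c)%N & bruhat S (va w * c)%g (va v)].

Definition Vle : V -> V -> Prop :=
  clos_refl_trans V (fun v w => Vle1 v w \/ Vle2 v w).

Definition Vinterval (w v : V) : pred V := fun z => `[< Vle w z /\ Vle z v >].

Definition Vdim (v : V) : int := - (l (va v))%:Z + (l (vb v))%:Z + #|vI v|%:Z.

Record is_Vaction (act : W * W -> V -> V) : Prop := IsVaction {
  Vact1 : forall v, act 1%g v = v;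
  VactM : forall x y v, act (x * y)%g v = act x (act y v);
  Vact_right : forall s v, s \in S ->
    Vtriple (act (1%g, s) v) = (vI v, va v, (s * vb v)%g);
  Vact_left_min : forall s v, s \in S -> (s * va v)%g \in min_reps (vI v) ->
    Vtriple (act (s, 1%g) v) = (vI v, (s * va v)%g, vb v);
  Vact_left_par : forall s t v, s \in S -> t \in vI v ->
    bruhat S (va v) (s * va v)%g -> (s * va v = va v * t)%g ->
    Vtriple (act (s, 1%g) v) = (vI v, va v, (vb v * t)%g) }.

Definition bold_gen (x : W * W) : bool :=
  (x.1 \in S) && (x.2 == 1%g) || (x.1 == 1%g) && (x.2 \in S).

(* V is finite, so the module with basis (m_v) and its completion coincide:   *)
(* both are the functions V -> laurent.                                       *)
Definition V_T (act : W * W -> V -> V) (s : W * W) :=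
  Tact (act s) (fun v => Vdim (act s v) < Vdim v).
Definition V_Tinv (act : W * W -> V -> V) (s : W * W) :=
  Tinv (act s) (fun v => Vdim (act s v) < Vdim v).

(* The semi-linear map sending m_v to the sum over w of b w v * m_w. *)
Definition semilinear_map (b : V -> V -> laurent) (f : V -> laurent) :
    V -> laurent :=
  fun w => \sum_(v : V) bar (f v) * b w v.

Record is_springer_matrix (act : W * W -> V -> V) (R : W -> W -> {poly int})
    (b : V -> V -> laurent) : Prop := IsSpringer {
  springer_T : forall s f w, bold_gen s ->
    semilinear_map b (V_T act s f) w = V_Tinv act s (semilinear_map b f) w;
  springer_base : forall w v, vb v = 1%g ->
    b w v = if (vI w \subset vI v) && (vb w \in <<vI v>>%g)
            then bar alpha ^+ (#|vI v| - #|vI w|)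
                 * Rtilde S R (va v * vb w)%g (va w)
            else 0 }.

Definition Vgamma (c : V -> V -> {poly int}) (w v : V) : laurent :=
  u ^ (Vdim w - Vdim v) * peval (u ^+ 2) (c w v).

Record is_V_KL_polynomials (b : V -> V -> laurent) (c : V -> V -> {poly int}) :
    Prop := IsVKL {
  VKL_le : forall w v, ~ Vle w v -> c w v = 0;
  VKL_diag : forall v, Vgamma c v v = 1;
  VKL_deg : forall w v, Vle w v -> w != v ->
    exists p : {poly int}, Vgamma c w v = u^-1 * peval u^-1 p;
  VKL_bar : forall w v, Vgamma c w v =
    \sum_(z | Vinterval w v z) b w z * bar (Vgamma c z v) }.

Record is_V_inverse_KL_polynomials (c cinv : V -> V -> {poly int}) : Prop :=
  IsVInverseKL {
  VKLinv_le : forall w v, ~ Vle w v -> cinv w v = 0;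
  VKLinv_inv : forall w v,
    \sum_(z | Vinterval w v z)
      (-1) ^ (Vdim z - Vdim w) * (c w z * cinv z v) = (w == v)%:R }.

(* W is identified with a subgroup of What along iota; as S generates W, the  *)
(* image of iota is the standard parabolic subgroup generated by iota(S).     *)
Record is_hat_system (What : groupType) (Shat : {pred What})
    (iota theta : W -> What) : Prop := IsHat {
  hat_coxeter : coxeter_system Shat;
  hat_iotaM : {morph iota : x y / (x * y)%g};
  hat_iota_inj : injective iota;
  hat_iotaS : forall s, s \in S -> iota s \in Shat;
  hat_theta_inj : {in S &, injective theta};
  hat_theta_image : forall t,
    t \in Shat /\ ~ (exists2 s, s \in S & t = iota s) <->
    exists2 s, s \in S & t = theta s;
  hat_commute : {in S &, forall r s,
    ~ commute (iota r) (theta s) <-> r = s} }.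

Definition hat_z (What : groupType) (theta : W -> What) (n : nat)
    (r : 'I_n -> W) (I : {set W}) : What :=
  (\prod_(i < n | r i \notin I) theta (r i))%g.

Definition phi (What : groupType) (iota theta : W -> What) (n : nat)
    (r : 'I_n -> W) (wS : W) (v : V) : What :=
  (iota (va v) * hat_z theta r (vI v) * (iota (vb v))^-1 * iota wS)%g.

End Poset.

(* Main.v *)
(* The order on V, the matrix b and the polynomials c are matched with the
   Bruhat order, the R-polynomials and the inverse Kazhdan-Lusztig polynomials
   of What as follows.

   The product iota a * z_I * iota b is reduced whenever a lies in W^I, and it
   determines (I, a, b).  This rests on the fact that g z_I = z_I h with g, h
   in W forces g in W_I: the letters theta s of z_I occur only once, so the
   exchange condition can never delete one of them, and s has to commute with
   theta s.  As subwords of a z_I b have the form a' z_J b' with I contained in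
   J, the subword property gives the order isomorphism.

   Both b_(w, v) and Rtilde(phi' v, phi' w) satisfy the recursion coming from
   the generators (1, s), which correspond to right multiplication by
   w_S s w_S; this reduces their equality to b_v = 1, where the common right
   factor b_w^-1 w_S and then the letters of z_I are stripped off.

   Writing P, Q, R for the normalised matrices on the finite lower interval,
   P = R P-bar and Q is the sign-twisted inverse of P, whence Q = Q-bar R; this
   and the degree bounds characterise the matrix of the c_(w, v). *)
From HB Require Import structures.
Require Import Defs.
From Stdlib Require Import Relation_Operators.
From mathcomp Require Import all_boot all_order all_algebra all_fingroup.
From mathcomp Require Import ring zify.
From mathcomp Require boolp classical_sets fsbigop.

Import GRing.Theory Num.Theory.

Set Implicit Arguments.
Unset Strict Implicit.
Unset Printing Implicit Defensive.

(** * Exchange and deletion *)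

(** The relation [Vle2] is commutation in disguise. An element [c] of [W_J] commutes with [z_J],
    because [theta t] fails to commute only with [t] and the letters of [z_J] have [t] outside [J].
    A subword [a' z_J b'] in which [a'] is not in [W^J] is therefore normalised by moving the
    [W_J]-part of [a'] across [z_J], and this transfer is what [Vle2] records. Using [b^-1 w_S]
    instead of [b] reverses the order in [b] as well, and makes a drop of the dimension in [V] a
    growth of the length in [What].

    The Coxeter systems are known only through a universal property, so strong exchange has to come
    from a morphism into a suitable group; the subword and lifting properties follow from it. As
    [What] may be infinite, matrix arguments take place over the finite type [V], whose image is
    closed downwards in the Bruhat order. The uniqueness behind the last claim comes down to one
    fact: an element of [u^-1 Z[u^-1]] fixed by [bar] is zero. *)

(* The semidirect product of the Boolean functions on G with G.  Mapping s in S
   to (indicator of s, s) defines a morphism x |-> (N x, x), where N x t is the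
   parity of the number of times that t occurs among the reflections attached
   to a word of x. *)
Record reflection_cocycle (G : groupType) := ReflCocycle {
  rc_fun : G -> bool; rc_elt : G }.

Section CocycleGroup.

Local Open Scope group_scope.

Variable G : groupType.
Implicit Types x y z : reflection_cocycle G.

HB.instance Definition _ := boolp.gen_eqMixin (reflection_cocycle G).
HB.instance Definition _ := boolp.gen_choiceMixin (reflection_cocycle G).

Definition rc_one := ReflCocycle (fun=> false) (1 : G).
Definition rc_mul x y :=
  ReflCocycle (fun t => rc_fun x t (+) rc_fun y (t ^ rc_elt x))
    (rc_elt x * rc_elt y).
Definition rc_inv x :=
  ReflCocycle (fun t => rc_fun x (t ^ (rc_elt x)^-1)) (rc_elt x)^-1.

Lemma rc_eq x y : rc_fun x =1 rc_fun y -> rc_elt x = rc_elt y -> x = y.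
Proof. by case: x y => f a [g b] /= /boolp.funext -> ->. Qed.

Lemma rc_mulA : associative rc_mul.
Proof.
by move=> x y z; apply: rc_eq => [t|] /=; rewrite ?mulgA // conjgM addbA.
Qed.

Lemma rc_mul1 : left_id rc_one rc_mul.
Proof. by move=> x; apply: rc_eq => [t|] /=; rewrite ?conjg1 ?mul1g. Qed.

Lemma rc_1mul : right_id rc_one rc_mul.
Proof. by move=> x; apply: rc_eq => [t|] /=; rewrite ?addbF ?mulg1. Qed.

Lemma rc_mulV : left_inverse rc_one rc_inv rc_mul.
Proof. by move=> x; apply: rc_eq => [t|] /=; rewrite ?addbb ?mulVg. Qed.

Lemma rc_Vmul : right_inverse rc_one rc_inv rc_mul.
Proof. by move=> x; apply: rc_eq => [t|] /=; rewrite ?conjgK ?addbb ?mulgV. Qed.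

HB.instance Definition _ := isGroup.Build (reflection_cocycle G)
  rc_mulA rc_mul1 rc_1mul rc_mulV rc_Vmul.

End CocycleGroup.

Section Coxeter.

Local Open Scope group_scope.

Variables (G : groupType) (S : {pred G}).
Hypothesis hS : coxeter_system S.

Implicit Types (x y z s t : G) (w : seq G).
Local Notation l := (cox_length S).
Local Notation wprod w := (\prod_(s <- w) s).
Local Notation refl := (reflection S).

Lemma prod1w s : wprod [:: s] = s. Proof. by rewrite big_seq1. Qed.

Lemma coxV s : s \in S -> s^-1 = s.
Proof. by move=> /(cox_invol hS)/mulg1_eq. Qed.

Lemma coxKl s x : s \in S -> s * (s * x) = x.
Proof. by move=> sS; rewrite mulgA (cox_invol hS) // mul1g. Qed.

Lemma coxKr s x : s \in S -> x * s * s = x.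
Proof. by move=> sS; rewrite -mulgA (cox_invol hS) // mulg1. Qed.

(** Only the defining relations need checking. The reflections attached to [(s * t) ^+ m] are
    [(s * t) ^+ j * s] for [j < 2 * m]; if [(s * t) ^+ n = 1], those of index [j] and [n + j]
    coincide, so every parity is even. *)
Lemma cocycle_exists : exists N : G -> G -> bool,
  (forall x y t, N (x * y) t = N x t (+) N y (t ^ x)) /\
  {in S, forall s t, N s t = (t == s)}.
Proof.
pose f s : reflection_cocycle G := ReflCocycle (pred1 s) s.
have [s t n sS tS stn|g [gM gS]] := @cox_universal _ _ hS _ f.
  have sV k : s * (s * t) ^- k = (s * t) ^+ k * s.
    have /(congr1 (fun c => c ^+ k)) : (s * t) ^ s = (s * t)^-1.
      by rewrite invMg !coxV // /conjg coxV // !mulgA (cox_invol hS) ?mul1g.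
    by rewrite -conjXg expVgn => <-; rewrite /conjg coxV // coxKl.
  have fX m : (f s * f t) ^+ m = ReflCocycle
      (fun c => \big[addb/false]_(0 <= j < m.*2) (c == (s * t) ^+ j * s))
      ((s * t) ^+ m).
    elim: m => [|m IHm]; first by apply: rc_eq => //= c; rewrite big_nil.
    rewrite expgSr IHm; apply: rc_eq => /= [c|]; last by rewrite -expgSr.
    rewrite doubleS !big_nat_recr //= -addbA; congr (_ (+) (_ (+) _)).
    - rewrite -[LHS](inj_eq (conjg_inj ((s * t) ^- m))) conjgK.
      by rewrite /conjg invgK sV mulgA -expgnDr addnn.
    - rewrite -conjgM -[LHS](inj_eq (conjg_inj ((s * t) ^+ m * s)^-1)) conjgK.
      rewrite /conjg invgK invMg coxV // sV !mulgA -[_ * s * t]mulgA -expgSr.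
      by rewrite -expgnDr addSn addnn.
  rewrite fX stn; apply: rc_eq => //= c.
  rewrite -addnn /index_iota subn0 iotaD big_cat /= add0n.
  have -> : iota n n = map (addn n) (iota 0 n) by rewrite -iotaDl addn0.
  rewrite big_map.
  rewrite [X in _ (+) X](eq_bigr (fun j => c == (s * t) ^+ j * s)) ?addbb
    // => j _.
  by rewrite expgnDr stn mul1g.
have gE x : rc_elt (g x) = x.
  have [w [/allP wS ->]] := cox_generate hS x.
  have g1 : g 1 = 1 by apply: (mulgI (g 1)); rewrite -gM !mulg1.
  elim: w wS => [|s w IHw] wS; first by rewrite big_nil g1.
  rewrite big_cons gM /= gS ?wS ?inE ?eqxx //= IHw // => t tw.
  by rewrite wS // inE tw orbT.
exists (fun x => rc_fun (g x)); split=> [x y t|s sS t]; last by rewrite gS.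
by rewrite gM /= gE.
Qed.

Lemma len_le w : all [in S] w -> (l (wprod w) <= size w)%N.
Proof.
move=> wS; rewrite /cox_length; case: boolp.pselect => // e.
case: ex_minnP => m _; apply; apply/boolp.asboolP.
by exists w.
Qed.

Lemma reduced_exists x : exists2 w, reduced S w & x = wprod w.
Proof.
have [w [wS xw]] := cox_generate hS x.
have ex : exists n, has_word S x n.
  by exists (size w); apply/boolp.asboolP; exists w.
suff: exists w', [/\ all [in S] w', size w' = l x & x = wprod w'].
  by move=> [w' [w'S sw' xw']]; exists w' => //; split=> //; rewrite -xw'.
rewrite /cox_length; case: boolp.pselect => // e.
by case: ex_minnP => m /boolp.asboolP.
Qed.

Lemma reduced_all w : reduced S w -> all [in S] w. Proof. by case. Qed.

Lemma len1 : l 1 = 0%N.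
Proof. by have := @len_le [::] isT; rewrite big_nil leqn0 => /eqP. Qed.

Lemma len_eq0 x : (l x == 0%N) = (x == 1).
Proof.
apply/eqP/eqP=> [|->]; last exact: len1.
by have [[|s w] [_ lw] ->] := reduced_exists x; rewrite ?lw ?big_nil.
Qed.

Lemma lenM x y : (l (x * y) <= l x + l y)%N.
Proof.
have [v [vS lv] ->] := reduced_exists x; have [w [wS lw] ->] := reduced_exists y.
by rewrite lv lw -big_cat -size_cat len_le // all_cat vS.
Qed.

Lemma wprodV w : all [in S] w -> (wprod w)^-1 = wprod (rev w).
Proof.
elim: w => [|s w IHw] /=; first by rewrite !big_nil invg1.
move=> /andP[sS wS]; rewrite rev_cons -cats1 big_cat big_cons invMg IHw //=.
by rewrite big_seq1 coxV.
Qed.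

Lemma lenV x : l x^-1 = l x.
Proof.
suff le y : (l y^-1 <= l y)%N.
  by apply/eqP; rewrite eqn_leq le -{1}[x]invgK le.
have [w [wS lw] ->] := reduced_exists y.
by rewrite wprodV // lw -size_rev len_le // all_rev.
Qed.

Lemma len_gen s : s \in S -> l s = 1%N.
Proof.
move=> sS; apply/eqP; rewrite eqn_leq -{1}[s]prod1w len_le /= ?sS //.
by rewrite lt0n len_eq0 (cox_neq1 hS).
Qed.

Lemma lenMl s x : s \in S -> (l (s * x) <= (l x).+1)%N.
Proof. by move=> sS; rewrite (leq_trans (lenM _ _)) // len_gen. Qed.

Lemma lenMr s x : s \in S -> (l (x * s) <= (l x).+1)%N.
Proof. by move=> sS; rewrite (leq_trans (lenM _ _)) // [l s]len_gen ?addnS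
  ?addn0. Qed.

Lemma refl_gen s : s \in S -> refl s.
Proof. by move=> sS; exists s, 1; rewrite conjg1. Qed.

Lemma reflJ t x : refl t -> refl (t ^ x).
Proof. by move=> [s [g [sS ->]]]; exists s, (g * x); rewrite conjgM. Qed.

Lemma reflV t : refl t -> t^-1 = t.
Proof. by move=> [s [g [sS ->]]]; rewrite -conjVg coxV. Qed.

Lemma reflKr t x : refl t -> x * t * t = x.
Proof. by move=> rt; rewrite -{2}[t]reflV // mulgK. Qed.

Lemma reflKl t x : refl t -> t * (t * x) = x.
Proof. by move=> rt; rewrite -{1}[t]reflV // mulKg. Qed.

(** An odd parity exhibits an occurrence of [t] among the reflections of the word, and multiplying
    by [t] on the left deletes the letter at that place. *)
Lemma cocycle_word N : (forall x y t, N (x * y) t = N x t (+) N y (t ^ x)) ->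
  {in S, forall s t, N s t = (t == s)} ->
  forall w t, all [in S] w -> N (wprod w) t ->
  exists w1 s w2, [/\ w = w1 ++ s :: w2 & t * wprod w = wprod (w1 ++ w2)].
Proof.
move=> NM NS; have N1 c : N 1 c = false.
  by have := NM 1 1 c; rewrite mulg1 conjg1; case: (N 1 c).
elim=> [|s w IHw] t /=; first by rewrite big_nil N1.
move=> /andP[sS wS]; rewrite big_cons NM NS //.
have [-> _|_ /= /IHw[//|w1 [s' [w2 [-> E]]]]] := eqVneq t s.
  by exists [::], s, w; split; rewrite // coxKl.
exists (s :: w1), s', w2; split=> //.
by rewrite mulgA (conjgC t) -mulgA E /= big_cons.
Qed.

(** With [t = g^-1 * s * g], the contributions of [g^-1] and [g] are equal because [N 1] vanishes,
    so they cancel; only that of the middle [s] survives. *)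
Lemma cocycle_refl N : (forall x y t, N (x * y) t = N x t (+) N y (t ^ x)) ->
  {in S, forall s t, N s t = (t == s)} -> forall t, refl t -> N t t.
Proof.
move=> NM NS _ [s [g [sS ->]]]; rewrite /conjg 2!NM.
have N1 : N (g^-1 * g) (g^-1 * (s * g)) = false.
  by have := NM 1 1 (s ^ g); rewrite mulVg mulg1 conjg1; case: (N 1 _).
move: N1; rewrite NM.
have -> : (g^-1 * (s * g)) ^ g^-1 = s by rewrite -[_ * _]/(s ^ g) conjgK.
rewrite (NS _ sS) eqxx; have -> : s ^ s = s by rewrite /conjg mulKg.
by case: (N g^-1 _); case: (N g _).
Qed.

Lemma cocycle_len N : (forall x y t, N (x * y) t = N x t (+) N y (t ^ x)) ->
  {in S, forall s t, N s t = (t == s)} ->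
  forall t x, N x t -> (l (t * x) < l x)%N.
Proof.
move=> NM NS t x; have [v [vS lv] ->] := reduced_exists x.
move=> /(cocycle_word NM NS vS)[w1 [s [w2 [vE ->]]]].
rewrite lv vE size_cat /= addnS ltnS -size_cat len_le //.
apply/allP=> s'; rewrite mem_cat => s'w; apply: (allP vS).
by rewrite vE mem_cat inE; case/orP: s'w => ->; rewrite ?orbT.
Qed.

(** As [N t t] holds, exactly one of [N x t] and [N (t * x) t] holds, and by [cocycle_len] it marks
    the longer of the elements [x] and [t * x]. *)
Lemma strong_exchangel w t : refl t -> all [in S] w ->
  (l (t * wprod w) < l (wprod w))%N ->
  exists w1 s w2, [/\ w = w1 ++ s :: w2 & t * wprod w = wprod (w1 ++ w2)].
Proof.
have [N [NM NS]] := cocycle_exists.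
have Nlen := cocycle_len NM NS.
move=> rt wS lt; apply: (cocycle_word NM NS) => //.
apply: contraLR lt => Nf; rewrite -leqNgt ltnW //.
rewrite -{1}[wprod w](reflKl _ rt) Nlen // NM (cocycle_refl NM NS) //.
by have -> : t ^ t = t by rewrite /conjg mulKg.
Qed.

Lemma len_refll t x : refl t -> l (t * x) <> l x.
Proof.
have [N [NM NS]] := cocycle_exists.
have Nlen := cocycle_len NM NS.
move=> rt le; case Nx: (N x t); first by have := Nlen _ _ Nx; rewrite le ltnn.
suff /Nlen : N (t * x) t by rewrite reflKl // le ltnn.
rewrite NM (cocycle_refl NM NS) //.
by have -> : t ^ t = t; rewrite /conjg ?mulKg // Nx.
Qed.

Lemma len_reflr t x : refl t -> l (x * t) <> l x.
Proof. by move=> rt; rewrite conjgCV; apply: len_refll; apply: reflJ. Qed.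

Lemma strong_exchanger w t : refl t -> all [in S] w ->
  (l (wprod w * t) < l (wprod w))%N ->
  exists w1 s w2, [/\ w = w1 ++ s :: w2 & wprod w * t = wprod (w1 ++ w2)].
Proof.
by move=> rt; rewrite conjgCV; apply: strong_exchangel; apply: reflJ.
Qed.

Lemma lenSl s x : s \in S -> (l x < l (s * x))%N = ~~ (l (s * x) < l x)%N.
Proof.
by move=> sS; have := @len_refll s x (refl_gen sS); case: ltngtP => // -> [].
Qed.

Lemma lenSr s x : s \in S -> (l x < l (x * s))%N = ~~ (l (x * s) < l x)%N.
Proof.
by move=> sS; have := @len_reflr s x (refl_gen sS); case: ltngtP => // -> [].
Qed.

Lemma len_upl s x : s \in S -> (l x < l (s * x))%N -> l (s * x) = (l x).+1.
Proof. by move=> sS lt; apply/eqP; rewrite eqn_leq lt lenMl. Qed.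

Lemma len_upr s x : s \in S -> (l x < l (x * s))%N -> l (x * s) = (l x).+1.
Proof. by move=> sS lt; apply/eqP; rewrite eqn_leq lt lenMr. Qed.

Lemma len_downl s x : s \in S -> (l (s * x) < l x)%N -> l x = (l (s * x)).+1.
Proof. by move=> sS; rewrite -{2 3}[x](coxKl _ sS) => /(len_upl sS). Qed.

Lemma subseq_del (w1 w2 : seq G) s : subseq (w1 ++ w2) (w1 ++ s :: w2).
Proof. by rewrite cat_subseq ?subseq_cons. Qed.

Lemma all_subseq w w' : subseq w' w -> all [in S] w -> all [in S] w'.
Proof. by move=> /mem_subseq sub /allP wS; apply/allP=> s /sub/wS. Qed.

Lemma deletion w : all [in S] w ->
  exists2 w', subseq w' w & reduced S w' /\ wprod w' = wprod w.
Proof.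
elim: w => [|s w IHw] /=.
  by exists [::] => //; split=> //; split; rewrite // big_nil len1.
move=> /andP[sS /IHw[w' sub [[w'S lw'] E]]].
have [up|] := boolP (l (wprod w') < l (s * wprod w'))%N.
  exists (s :: w'); first by rewrite /= eqxx.
  split; last by rewrite !big_cons E.
  by split; rewrite /= ?sS // big_cons len_upl // lw'.
rewrite lenSl // negbK => down.
have [w1 [s' [w2 [w'E E']]]] := strong_exchangel (refl_gen sS) w'S down.
have sub' : subseq (w1 ++ w2) w' by rewrite w'E subseq_del.
exists (w1 ++ w2).
  exact: subseq_trans (subseq_trans sub' sub) (subseq_cons _ _).
split; last by rewrite -E' big_cons E.
split; first exact: all_subseq sub' w'S.
apply/succn_inj; rewrite -E' -len_downl // lw' w'E !size_cat /=.
by rewrite addnS.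
Qed.

Lemma reduced_catl v w : reduced S (v ++ w) -> reduced S v.
Proof.
move=> [vwS lvw]; have := vwS; rewrite all_cat => /andP[vS wS].
split=> //; apply/eqP; rewrite eqn_leq len_le //.
rewrite -(leq_add2r (size w)) -size_cat -lvw big_cat (leq_trans (lenM _ _)) //.
by rewrite leq_add2l len_le.
Qed.

Lemma reduced_catr v w : reduced S (v ++ w) -> reduced S w.
Proof.
move=> [vwS lvw]; have := vwS; rewrite all_cat => /andP[vS wS].
split=> //; apply/eqP; rewrite eqn_leq len_le //.
rewrite -(leq_add2l (size v)) -size_cat -lvw big_cat (leq_trans (lenM _ _)) //.
by rewrite leq_add2r len_le.
Qed.

Lemma reduced_cat v w : reduced S v -> reduced S w ->
  l (wprod v * wprod w) = (l (wprod v) + l (wprod w))%N -> reduced S (v ++ w).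
Proof.
move=> [vS lv] [wS lw] lvw; split; first by rewrite all_cat vS.
by rewrite big_cat size_cat -lv -lw.
Qed.

Lemma gen_mem_word s w : s \in S -> all [in S] w -> s = wprod w -> s \in w.
Proof.
move=> sS /deletion[w' /mem_subseq sub [[w'S lw'] E]] sE; apply: sub.
move: lw'; rewrite E -sE len_gen //.
case: w' w'S E => [|s' [|]] //= _; rewrite big_seq1 -sE => -> _.
exact: mem_head.
Qed.

(* Solving the equation for s writes s as a product of the other letters. *)
Lemma letter_once s w1 w2 v : s \in S -> all [in S] (w1 ++ w2) ->
  all [in S] v -> wprod (w1 ++ s :: w2) = wprod v ->
  s \in w1 ++ w2 ++ v.
Proof.
move=> sS; rewrite all_cat => /andP[w1S w2S] vS E.
suff: s \in rev w1 ++ v ++ rev w2 by rewrite !mem_cat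
  !mem_rev [(_ \in v) || _]orbC.
apply: gen_mem_word => //; first by rewrite !all_cat !all_rev w1S vS.
rewrite !big_cat -!wprodV //= -E big_cat big_cons /=.
by rewrite mulgA mulKg mulgK.
Qed.

(** * The Bruhat order: subwords and lifting *)

Lemma bruhat_trans x y z : bruhat S x y -> bruhat S y z -> bruhat S x z.
Proof. by move=> xy; elim=> // {}z t _ xz rt lt; apply: bruhat_step. Qed.

Lemma bruhat_lt t x : refl t -> (l x < l (x * t))%N -> bruhat S x (x * t).
Proof. by move=> rt lt; apply: bruhat_step => //; apply: bruhat_refl. Qed.

Lemma bruhat_ltl t x : refl t -> (l x < l (t * x))%N -> bruhat S x (t * x).
Proof. by move=> rt; rewrite conjgC; apply: bruhat_lt; apply: reflJ. Qed.

Lemma bruhat_len x y : bruhat S x y -> (l x < l y)%N \/ x = y.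
Proof.
elim=> [|{}y t _ IH rt lt]; first by right.
by left; case: IH => [/ltn_trans->|->].
Qed.

Lemma bruhat_leq x y : bruhat S x y -> (l x <= l y)%N.
Proof. by case/bruhat_len=> [/ltnW|->]. Qed.

Lemma bruhat_anti x y : bruhat S x y -> bruhat S y x -> x = y.
Proof. by move=> /bruhat_len[lt|//] /bruhat_leq; rewrite leqNgt lt. Qed.

(** The word [w] need not be reduced: each step down the chain deletes one letter by strong
    exchange, and [deletion] reduces what remains. *)
Lemma bruhat_subword w x : all [in S] w -> bruhat S x (wprod w) ->
  exists2 w', subseq w' w & reduced S w' /\ wprod w' = x.
Proof.
move=> wS; move Ey: (wprod w) => y xy.
elim: xy w wS Ey => [w wS <-|{}y t xy IH rt lt w wS wE]; first exact: deletion.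
have := @strong_exchanger w t rt wS; rewrite wE reflKr // => /(_ lt).
move=> [w1 [s [w2 [wE2 /esym yE]]]].
have sub : subseq (w1 ++ w2) w by rewrite wE2 subseq_del.
have [w' sub' w'P] := IH _ (all_subseq sub wS) yE.
by exists w'; rewrite // (subseq_trans sub').
Qed.

(** The lifting property. The only bad step has [y < y t] but [s y t < s y]. Exchange in [s]
    followed by a reduced word of [y] must then delete the leading [s], since any other deletion
    would shorten [y t] below [y]; hence [s y = y t]. *)
Lemma bruhat_mulS s x y : s \in S -> bruhat S x y ->
  bruhat S (s * x) (s * y) \/ bruhat S (s * x) y.
Proof.
move=> sS; elim=> [|{}y t xy IH rt lt]; first by left; apply: bruhat_refl.
case: IH => [IH|IH]; last by right; apply: bruhat_step.
have [lt'|] := ltnP (l (s * y)) (l (s * y * t)).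
  by left; rewrite mulgA; apply: bruhat_step.
rewrite leq_eqVlt => /orP[/eqP/(len_reflr rt)//|lt'].
right; suff <- : s * y = y * t by [].
have [w [wS lw] yw] := reduced_exists y.
have [| |[|s' w1] [s'' [w2 [/= ]]]] := @strong_exchanger (s :: w) t rt.
- by rewrite /= sS.
- by rewrite big_cons -yw.
- by move=> [_ <-]; rewrite big_cons -yw => E; rewrite -{2}E reflKr.
move=> [<- wE]; rewrite !big_cons -yw -mulgA => /mulgI yt.
move: lt; rewrite yt yw lw wE ltnNge => /negP[].
rewrite (leq_trans (len_le _)) ?(all_subseq (subseq_del w1 w2 s'')) -?wE //.
by rewrite wE !size_cat /= addnS.
Qed.

Lemma bruhat_mulSl s x y : s \in S -> (l y < l (s * y))%N -> bruhat S x y ->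
  bruhat S (s * x) (s * y).
Proof.
move=> sS lt /(bruhat_mulS sS)[//|xy]; apply: bruhat_trans xy _.
by apply: bruhat_ltl => //; apply: refl_gen.
Qed.

Lemma reduced_cons s w : reduced S (s :: w) -> 
  [/\ s \in S, reduced S w & (l (wprod w) < l (s * wprod w))%N].
Proof.
move=> sw; have [swS lsw] := sw; have [//|_ lw] := @reduced_catr [:: s] w.
by move: swS lsw => /= /andP[sS wS]; rewrite big_cons => ->; rewrite lw.
Qed.

Lemma subword_bruhat w w' : reduced S w -> subseq w' w ->
  bruhat S (wprod w') (wprod w).
Proof.
elim: w w' => [|s w IHw] w'.
  by move=> _; rewrite subseq0 => /eqP->; apply: bruhat_refl.
move=> /reduced_cons[sS rw lt]; case: w' => [|s' w'].
  move=> _; rewrite big_cons; apply: (bruhat_trans (IHw [::] rw (sub0seq _))).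
  by apply: bruhat_ltl => //; apply: refl_gen.
rewrite /=; case: eqVneq => [->|_] sub.
  by rewrite !big_cons; apply: bruhat_mulSl => //; apply: IHw.
rewrite [X in bruhat _ _ X]big_cons; apply: (bruhat_trans (IHw _ rw sub)).
by apply: bruhat_ltl => //; apply: refl_gen.
Qed.

End Coxeter.

Lemma cat_cons_split (T : Type) (v w w1 w2 : seq T) s :
  v ++ w = w1 ++ s :: w2 ->
  (exists v2, v = w1 ++ s :: v2 /\ w2 = v2 ++ w) \/
  (exists v1, w1 = v ++ v1 /\ w = v1 ++ s :: w2).
Proof.
elim: v w1 => [|a v IHv] [|b w1] /=.
- by right; exists [::].
- by right; exists (b :: w1).
- by case=> -> <-; left; exists v.
- case=> -> /IHv[[v2 [-> ->]]|[v1 [-> ->]]]; first by left; exists v2.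
  by right; exists v1.
Qed.

Section Coxeter2.

Local Open Scope group_scope.

Variables (G : groupType) (S : {pred G}).
Hypothesis hS : coxeter_system S.

Implicit Types (x y z s t : G) (v w : seq G).
Local Notation l := (cox_length S).
Local Notation wprod w := (\prod_(s <- w) s).
Local Notation refl := (reflection S).

Lemma exchange_cat t v w : refl t -> all [in S] v -> all [in S] w ->
  (l (wprod v * wprod w * t) < l (wprod v * wprod w))%N ->
  (exists v1 s v2, v = v1 ++ s :: v2 /\
     wprod v * wprod w * t = wprod (v1 ++ v2) * wprod w) \/
  (exists w1 s w2, w = w1 ++ s :: w2 /\ wprod w * t = wprod (w1 ++ w2)).
Proof.
move=> rt vS wS; rewrite -big_cat => lt.
have := strong_exchanger hS rt _ lt; rewrite all_cat vS =>
  /(_ wS)[u1 [s [u2 [/esym E0 E]]]].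
have [[v2 [vE u2E]]|[v1 [u1E wE]]] := cat_cons_split (esym E0).
  by left; exists u1, s, v2; split; rewrite // -big_cat E u2E catA.
right; exists v1, s, u2; split=> //; apply: (mulgI (wprod v)).
by rewrite mulgA -!big_cat E u1E catA.
Qed.

Lemma len_del w1 w2 s : reduced S (w1 ++ s :: w2) ->
  (l (wprod (w1 ++ w2)%SEQ) < l (wprod (w1 ++ s :: w2)%SEQ))%N.
Proof.
move=> [wS lw]; rewrite lw size_cat /= addnS ltnS -size_cat.
by rewrite (len_le (all_subseq (subseq_del _ _ s) wS)).
Qed.

Lemma reduced_rcons w s : reduced S (rcons w s) ->
  [/\ s \in S, reduced S w & l (wprod w * s) = (size w).+1].
Proof.
rewrite -cats1 => r; have [wS lw] := r.
split; [|exact: (reduced_catl hS r)|]; first by move: wS;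
  rewrite all_cat /= => /and3P[].
by move: lw; rewrite big_cat /= big_seq1 size_cat addn1.
Qed.

Lemma reducedV w : reduced S w -> reduced S (rev w).
Proof.
move=> [wS lw]; split; first by rewrite all_rev.
by rewrite -(wprodV hS) // (lenV hS) lw size_rev.
Qed.

Lemma bruhatV x y : bruhat S x y -> bruhat S x^-1 y^-1.
Proof.
elim=> [|{}y t _ IH rt lt]; first exact: bruhat_refl.
rewrite invMg (reflV hS rt); apply: (bruhat_trans IH).
have E : t * y^-1 = (y * t)^-1 by rewrite invMg (reflV hS rt).
by apply: bruhat_ltl; rewrite // E !(lenV hS).
Qed.

Lemma bruhat_cat x1 y1 x2 y2 : l (y1 * y2) = (l y1 + l y2)%N ->
  bruhat S x1 y1 -> bruhat S x2 y2 -> bruhat S (x1 * x2) (y1 * y2).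
Proof.
have [v rv ->] := reduced_exists hS y1; have [w rw ->] := reduced_exists hS y2.
move=> /(reduced_cat rv rw) rvw.
move=> /(bruhat_subword hS (reduced_all rv))[v' sv [_ <-]].
move=> /(bruhat_subword hS (reduced_all rw))[w' sw [_ <-]].
by rewrite -!big_cat; apply: (subword_bruhat hS) => //; apply: cat_subseq.
Qed.

Lemma bruhat_gen s x : s \in S ->
  bruhat S x (x * s) <-> (l x < l (x * s))%N.
Proof.
move=> sS; split=> [/(bruhat_len)[//|/esym/eqP]|]; last first.
  exact/bruhat_lt/refl_gen.
by rewrite -{2}[x]mulg1 (inj_eq (mulgI x)) (negPf (cox_neq1 hS sS)).
Qed.

Lemma bruhat_genl s x : s \in S ->
  bruhat S x (s * x) <-> (l x < l (s * x))%N.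
Proof.
move=> sS; split=> [/(bruhat_len)[//|/esym/eqP]|]; last first.
  exact/bruhat_ltl/refl_gen.
by rewrite -{2}[x]mul1g (inj_eq (mulIg x)) (negPf (cox_neq1 hS sS)).
Qed.

(** Exchange in [s] followed by a reduced word of [x] must delete [s], as a deletion inside [x]
    would give [x t < x]. *)
Lemma square_eq s t x : s \in S -> t \in S ->
  (l x < l (x * t))%N -> (l (s * x * t) < l (s * x))%N -> s * x = x * t.
Proof.
move=> sS tS lt lt'; have [w rw xw] := reduced_exists hS x.
move: lt'; rewrite -{1 2}[s]prod1w xw.
move=> /(exchange_cat (refl_gen tS) _ (reduced_all rw)) /=.
rewrite sS => /(_ isT)[[[|s' v1] [s'' [v2 [[]]]]]|[w1 [s' [w2 [wE E]]]]].
- move=> _ <-; rewrite big_seq1 big_nil mul1g => /(congr1 (fun y => y * t)).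
  by rewrite (coxKr hS).
- by case: v1.
have := len_del (s := s') (w1 := w1) (w2 := w2); rewrite -wE => /(_ rw).
by rewrite -E -xw ltnNge ltnW.
Qed.

Lemma square_ltr s t x : s \in S -> t \in S -> s * x <> x * t ->
  (l (s * x) < l (s * x * t))%N = (l x < l (x * t))%N.
Proof.
move=> sS tS ne; apply/idP/idP => [lt|lt]; rewrite (lenSr hS) //; apply/negP.
  move=> lt'; apply: ne; apply: (mulgI s).
  rewrite [RHS]mulgA; apply: (square_eq sS tS lt).
  by rewrite -[s * (s * x) * t]mulgA -!mulgA !(coxKl hS).
by move/(square_eq sS tS lt)/ne.
Qed.

Lemma square_ltl s t x : s \in S -> t \in S -> s * x <> x * t ->
  (l (x * t) < l (s * x * t))%N = (l x < l (s * x))%N.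
Proof.
move=> sS tS ne; have := @square_ltr t s x^-1 tS sS.
have E1 : l (t * x^-1) = l (x * t).
  by rewrite -(lenV hS) invMg invgK (coxV hS tS).
have E2 : l (x^-1 * s) = l (s * x).
  by rewrite -(lenV hS) invMg invgK (coxV hS sS).
have E3 : l (t * x^-1 * s) = l (s * x * t).
  by rewrite -(lenV hS) !invMg invgK (coxV hS sS) (coxV hS tS) mulgA.
rewrite E1 E2 E3 (lenV hS); apply=> E; apply: ne; apply: invg_inj.
by rewrite !invMg (coxV hS sS) (coxV hS tS).
Qed.

(** * The longest element *)

Section Longest.

Variable w0 : G.
Hypothesis hw0 : forall x, (l x <= l w0)%N.

Lemma longest_word w : reduced S w ->
  (l ((wprod w)^-1 * w0) + size w)%N = l w0.
Proof.
elim/last_ind: w => [|w s IHw]; first by rewrite big_nil invg1 mul1g addn0.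
move=> /reduced_rcons[sS rw lws]; have /= IH := IHw rw.
rewrite -cats1 big_cat big_seq1 size_cat addn1 invMg (coxV hS) // -mulgA.
set x' := _ * w0 in IH *; have [v rv x'v] := reduced_exists hS x'.
rewrite addnS -addSn -len_downl // x'v.
have E : wprod w * wprod v = w0 by rewrite -x'v /x' mulVKg.
(* The product of [w0] with this reflection is [w s v], shorter than [w0] by maximality. Exchange in
   [w v] cannot delete a letter of [w], which would make [w s] shorter than [w]; so it deletes one
   of [v], and [s v] is shorter than [v]. *)
have rt : refl (s ^ wprod v) by apply/reflJ/refl_gen.
have := exchange_cat rt (reduced_all rw) (reduced_all rv).
have le : (l (w0 * s ^ wprod v) <= l w0)%N by exact: hw0.
rewrite E ltn_neqAle le andbT; case: eqP => [/(len_reflr hS rt) //|_].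
case=> // [[w1 [s' [w2 [wE]]]]|[v1 [s' [v2 [vE]]]]].
  rewrite -E -mulgA -conjgC mulgA => /mulIg F.
  have : (l (wprod w * s) < l (wprod w))%N by rewrite F wE len_del -?wE.
  by rewrite lws (proj2 rw) ltnNge ltnW.
by rewrite -conjgC => ->; rewrite vE len_del -?vE.
Qed.

Lemma longest_lenV x : (l (x^-1 * w0) + l x)%N = l w0.
Proof.
have [w rw ->] := reduced_exists hS x.
by rewrite (proj2 rw) longest_word.
Qed.

Lemma longest_lenl x : (l (x * w0) + l x)%N = l w0.
Proof. by have := longest_lenV x^-1; rewrite invgK (lenV hS). Qed.

Lemma longest_invol : w0 * w0 = 1.
Proof.
by apply/eqP; rewrite -(len_eq0 hS) -(eqn_add2r (l w0)) longest_lenl.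
Qed.

Lemma longestV : w0^-1 = w0.
Proof. exact/mulg1_eq/longest_invol. Qed.

Lemma longest_lenr x : (l (w0 * x) + l x)%N = l w0.
Proof.
rewrite -(lenV hS) invMg longestV -[X in (_ + X)%N](lenV hS).
exact: longest_lenl.
Qed.

Lemma longest_antil x y : bruhat S x y -> bruhat S (w0 * y) (w0 * x).
Proof.
elim=> [|{}y t _ IH rt lt]; first exact: bruhat_refl.
apply: bruhat_trans IH.
have E : w0 * y = w0 * (y * t) * t by rewrite -mulgA (reflKr hS _ rt).
rewrite E; apply: bruhat_lt; rewrite // -E.
by rewrite -(ltn_add2r (l y)) longest_lenr -(longest_lenr (y * t)) ltn_add2l.
Qed.

Lemma longest_antir x y : bruhat S x y -> bruhat S (y * w0) (x * w0).
Proof.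
move=> /bruhatV/longest_antil/bruhatV.
by rewrite !invMg !invgK longestV.
Qed.

End Longest.

(** * The Hecke bar involution and the recursions for [Rtilde] *)

Section RPolynomials.

Variable R : G -> G -> {poly int}.
Hypothesis hR : is_R_polynomials S R.

Local Notation beta := (bar alpha).
Local Notation rho := (Rtilde S R).
Local Open Scope ring_scope.

Lemma bar_alpha : beta = - alpha.
Proof. by rewrite /alpha rmorphB rmorphV ?u_unit //= bar_u invrK opprB. Qed.

(** At a descent the [alpha] of [T_s] cancels against the one in [T_s^-1 = T_s - alpha]; only at
    ascents does [- alpha = bar alpha] remain. *)
Lemma hecke_barS s w x : s \in S -> hecke_bar S (s :: w) x =
  hecke_bar S w (s * x)%g +
  (if (l x < l (s * x)%g)%N then beta * hecke_bar S w x else 0).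
Proof.
move=> sS; rewrite /= /hecke_Tinv /Tinv /Tact -addrA; congr (_ + _).
have -> : boolp.asbool (bruhat S x (s * x)%g) = (l x < l (s * x)%g)%N.
  have [b2l l2b] := bruhat_genl x sS.
  by apply/boolp.asboolP/idP; [apply: b2l | apply: l2b].
by case: leqP => _ /=; rewrite ?add0r ?subrr // bar_alpha mulNr.
Qed.

(** The coefficients are polynomials in [bar alpha] whose exponents all have the parity of
    [l x + size w], and [bar] changes the sign of [alpha]. *)
Lemma bar_hecke_bar w x : all [in S] w ->
  bar (hecke_bar S w x) = (-1) ^+ (l x + size w)%N * hecke_bar S w x.
Proof.
elim: w x => [|s w IHw] x.
  move=> _ /=; case: eqVneq => [->|_]; last by rewrite rmorph0 mulr0.
  by rewrite len1 expr0 rmorph1 mulr1.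
move=> /andP[sS wS]; rewrite !(hecke_barS w) // -[size (s :: w)]/(size w).+1.
rewrite rmorphD /= IHw // mulrDr.
apply: f_equal2; first apply: f_equal2 => //.
  have [lt|] := boolP (l x < l (s * x)%g)%N.
    by rewrite (len_upl hS sS lt) addnS addSn.
  rewrite (lenSl hS) // negbK => /(len_downl hS sS) ->.
  by rewrite addnS addSn !exprS !mulN1r opprK.
case: ifP => _; last by rewrite rmorph0 mulr0.
rewrite rmorphM /= barK IHw // bar_alpha addnS exprS.
by rewrite mulN1r !mulNr mulrN opprK mulrCA.
Qed.

Lemma bar_klnorm_word w x : reduced S w ->
  bar (klnorm S R x (wprod w)%g) = hecke_bar S w x.
Proof. by move=> rw; rewrite hR. Qed.

Lemma Rtilde_klnorm x y :
  rho x y = (-1) ^+ (l x + l y)%N * klnorm S R x y.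
Proof.
rewrite /Rtilde /klnorm mulrA; congr (_ * _).
rewrite -[- u]mulN1r exprzMl ?unitrN1 ?u_unit //; congr (_ * _).
rewrite exprzDr ?unitrN1 // exprD; congr (_ * _).
by rewrite -exprz_inv invrN1.
Qed.

(** [klnorm] and [Rtilde] differ by the sign [(-1) ^+ (l x + l y)], which is also the effect of
    [bar] on the coefficients of [hecke_bar]. This turns the definition of the R-polynomials into a
    recursion for [Rtilde]. *)
Lemma bar_klnorm x y : bar (klnorm S R x y) = rho x y.
Proof.
have [w rw ->] := reduced_exists hS y.
rewrite Rtilde_klnorm; have := bar_klnorm_word x rw => E.
rewrite -[X in _ * X]barK E bar_hecke_bar ?(reduced_all rw) // (proj2 rw).
by rewrite mulrA -exprMn mulrNN mulr1 expr1n mul1r.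
Qed.

Lemma bar_Rtilde x y : bar (rho x y) = (-1) ^+ (l x + l y)%N * rho x y.
Proof.
rewrite -bar_klnorm barK bar_klnorm Rtilde_klnorm mulrA -exprMn.
by rewrite mulrNN mulr1 expr1n mul1r.
Qed.

Lemma Rtilde_l s x y : s \in S -> (l y < l (s * y)%g)%N ->
  rho x (s * y)%g = rho (s * x)%g y +
    (if (l x < l (s * x)%g)%N then beta * rho x y else 0).
Proof.
move=> sS; have [w rw ->] := reduced_exists hS y => lt.
have rsw : reduced S (s :: w).
  split; first by rewrite /= sS reduced_all.
  by rewrite big_cons (len_upl hS) // (proj2 rw).
have := hecke_barS w x sS; rewrite -!bar_klnorm_word // big_cons.
by rewrite !bar_klnorm.
Qed.

Lemma Rtilde_1 x : rho x 1%g = (x == 1%g)%:R.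
Proof.
have r0 : reduced S [::] by split; rewrite // big_nil len1.
by have := bar_klnorm_word x r0; rewrite big_nil bar_klnorm.
Qed.

(** The Hecke bar involution yields only the left recursion, so [y] is built up by left letters [s].
    The two recursions commute because left multiplication by [s] preserves right ascents at [t],
    and conversely, unless [s x = x t]; in that case all terms involve just [x] and [x t] and are
    compared directly. *)
Lemma Rtilde_r t x y : t \in S -> (l y < l (y * t)%g)%N ->
  rho x (y * t)%g = rho (x * t)%g y +
    (if (l x < l (x * t)%g)%N then beta * rho x y else 0).
Proof.
move=> tS; have [w rw ->] := reduced_exists hS y.
elim: w rw x => [|s w IHw] rw x.
  rewrite big_nil mul1g -{1 2}[t]mulg1 => lt.
  rewrite Rtilde_l // !Rtilde_1; congr (_ + _).
    by rewrite !mulg_eq1 [t == _]eq_sym eqg_invLR.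
  have [->|nx] := eqVneq x 1%g; first by rewrite mul1g mulg1.
  by rewrite !mulr0 !if_same.
have [sS rw' lt] := reduced_cons hS rw; rewrite big_cons => lt'.
have lt1 : (l (wprod w)%g < l (wprod w * t)%g)%N.
  rewrite ltnNge; apply/negP => le; move: lt'; rewrite ltnNge => /negP[].
  by rewrite -mulgA (leq_trans (lenMl hS _ sS)) // (leq_ltn_trans le).
have lt2 : (l (wprod w * t)%g < l (s * (wprod w * t))%g)%N.
  move: lt'; rewrite mulgA (len_upl hS sS lt); apply: leq_trans.
  by rewrite ltnS lenMr.
rewrite -mulgA (Rtilde_l x sS lt2) !(Rtilde_l _ sS lt) !IHw // !mulgA.
have [E|/eqP ne] := eqVneq (s * x)%g (x * t)%g; last first.
  rewrite square_ltr // -(square_ltl sS tS ne).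
  by case: ifP => _; case: ifP => _; ring.
have Ex : (x * t * t)%g = x by rewrite (coxKr hS).
rewrite E Ex.
by case: ifP => _; case: ifP => _; ring.
Qed.

End RPolynomials.
End Coxeter2.

(** * R-polynomials *)

Section RTheory.

Local Open Scope group_scope.

Variables (G : groupType) (S : {pred G}).
Hypothesis hS : coxeter_system S.
Variable R : G -> G -> {poly int}.
Hypothesis hR : is_R_polynomials S R.

Implicit Types (x y z s t : G) (v w : seq G).
Local Notation l := (cox_length S).
Local Notation wprod w := (\prod_(s <- w) s).
Local Notation rho := (Rtilde S R).
Local Open Scope ring_scope.

Lemma Rtilde_eq0 x y : ~ bruhat S x y -> rho x y = 0.
Proof.
have [w rw ->] := reduced_exists hS y.
elim: w rw x => [|s w IHw] rw x.
  rewrite big_nil Rtilde_1 //; case: eqP => // -> [].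
  exact: bruhat_refl.
have [sS rw' lt] := reduced_cons hS rw; rewrite big_cons => nle.
have le := bruhat_ltl (refl_gen sS) lt.
rewrite (Rtilde_l hS hR x sS lt) !IHw //; first by rewrite mulr0 if_same addr0.
  by move=> xw; apply: nle; apply: bruhat_trans xw le.
move=> xw; apply: nle; rewrite -(coxKl hS x sS).
exact: (bruhat_mulSl hS sS lt xw).
Qed.

Lemma Rtilde_diag x : rho x x = 1.
Proof.
have [w rw ->] := reduced_exists hS x.
elim: w rw => [|s w IHw] rw; first by rewrite big_nil Rtilde_1 // eqxx.
have [sS rw' lt] := reduced_cons hS rw; rewrite big_cons.
by rewrite (Rtilde_l hS hR _ sS lt) (coxKl hS _ sS) IHw // ltnNge (ltnW lt) addr0.
Qed.

Lemma Rtilde_rr t x y : t \in S -> (l x < l (x * t)%g)%N ->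
  (l y < l (y * t)%g)%N -> rho (x * t)%g (y * t)%g = rho x y.
Proof.
move=> tS ltx lty; rewrite (Rtilde_r hS hR _ tS lty) (coxKr hS _ tS).
by rewrite ltnNge (ltnW ltx) addr0.
Qed.

Lemma Rtilde_cat x y z : l (x * z)%g = (l x + l z)%N ->
  l (y * z)%g = (l y + l z)%N -> rho (x * z)%g (y * z)%g = rho x y.
Proof.
have [w rw ->] := reduced_exists hS z.
elim/last_ind: w rw => [|w s IHw] rw; first by rewrite big_nil !mulg1.
have [sS rw' lws] := reduced_rcons hS rw.
have lw := proj2 rw'; rewrite -cats1 big_cat big_seq1 /= lws !mulgA !addnS.
(* Additivity for [w] followed by [s] forces additivity for [w] and an ascent at [s]: the length of
   [c * w] is at most [l c + size w] and grows by at most one. *)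
have aux c : l (c * wprod w * s)%g = (l c + size w).+1 ->
    l (c * wprod w)%g = (l c + l (wprod w))%N /\
    (l (c * wprod w)%g < l (c * wprod w * s)%g)%N.
  move=> E; have : (l (c * wprod w)%g <= l c + size w)%N.
    by rewrite -lw lenM.
  rewrite E ltnS => le; split=> //; apply/eqP; rewrite eqn_leq lw le.
  by rewrite -ltnS -E lenMr.
by move=> /aux[Ex ltx] /aux[Ey lty]; rewrite Rtilde_rr // IHw.
Qed.

End RTheory.

(** * Parabolic subgroups *)

Section Parabolic.

Local Open Scope group_scope.

Variables (W : finGroupType) (S : {set W}).
Hypothesis hS : coxeter_system S.

Implicit Types (x y a c s t : W) (v w : seq W) (I J : {set W}).
Local Notation l := (cox_length S).
Local Notation wprod w := (\prod_(s <- w) s).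

Lemma gen_wordP I c :
  reflect (exists2 w, all [in I] w & c = wprod w) (c \in <<I>>).
Proof.
apply: (iffP gen_prodgP) => [[n [f fI ->]]|[w /allP wI ->]].
  exists [seq f i | i <- index_enum 'I_n]; last by rewrite big_map.
  by apply/allP=> _ /mapP[i _ ->]; apply: fI.
exists (size w), (fun i => nth 1 w i) => [i|]; first by apply: wI;
  rewrite mem_nth.
by rewrite (big_nth 1) big_mkord.
Qed.

Lemma all_sub I J w : I \subset J -> all [in I] w -> all [in J] w.
Proof. by move=> /subsetP IJ; apply: sub_all. Qed.

Lemma gen_reduced I c : I \subset S -> c \in <<I>> ->
  exists w, [/\ all [in I] w, reduced S w & c = wprod w].
Proof.
move=> IS /gen_wordP[w wI ->].
have [w' sub [rw' E]] := deletion hS (all_sub IS wI).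
by exists w'; split=> //; apply: all_subseq sub wI.
Qed.

Lemma min_repsP I a : I \subset S ->
  reflect (forall s, s \in I -> (l a < l (a * s))%N) (a \in min_reps S I).
Proof.
move=> /subsetP IS; rewrite inE; apply: (iffP (boolp.asboolP _)) => H s sI.
  by apply/(bruhat_gen hS a (IS s sI)); apply: H.
by apply/(bruhat_gen hS a (IS s sI)); apply: H.
Qed.

(** If a further letter [s] failed to lengthen [a w], exchange would delete a letter of [a], giving
    a shorter element of the coset [a W_I], or one of [w], which with [s] is reduced. *)
Lemma coset_min_len I a : I \subset S ->
  (forall c, c \in <<I>> -> (l a <= l (a * c))%N) ->
  forall c, c \in <<I>> -> l (a * c) = (l a + l c)%N.
Proof.
move=> IS amin c /(gen_reduced IS)[w [wI rw ->]].
have [v rv av] := reduced_exists hS a.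
elim/last_ind: w wI rw => [|w s IHw]; first by rewrite big_nil mulg1 len1 addn0.
rewrite all_rcons => /andP[sI wI] /(reduced_rcons hS)[sS rw lws].
rewrite -cats1 big_cat big_seq1 /= lws mulgA addnS -(proj2 rw) -IHw //.
apply: len_upr => //; rewrite lenSr //; apply/negP; rewrite {1 2}av.
case/(exchange_cat hS (refl_gen sS) (reduced_all rv) (reduced_all rw)).
  move=> [v1 [s' [v2 [vE E]]]]; have := len_del (S := S) (s := s') (w1 :=
    v1) (w2 := v2).
  rewrite -vE -av => /(_ rv); rewrite ltnNge => /negP[].
  have -> : wprod (v1 ++ v2) = a * (wprod w * s * (wprod w)^-1).
    by rewrite !mulgA {1}av E mulgK.
  apply: amin; have wc : wprod w \in <<I>> by apply/gen_wordP; exists w.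
  by rewrite !groupM ?groupV // mem_gen.
move=> [w1 [s' [w2 [wE E]]]]; have := len_del (S := S) (s := s') (w1 :=
  w1) (w2 := w2).
by rewrite -wE -E => /(_ rw); rewrite lws (proj2 rw) ltnNge ltnW.
Qed.

Lemma coset_min_exists I x : I \subset S -> exists a c,
  [/\ forall c', c' \in <<I>> -> l (a * c') = (l a + l c')%N,
      c \in <<I>> & x = a * c].
Proof.
move=> IS; have xx : x \in x *: <<I>> by rewrite lcoset_refl.
case: (arg_minnP (P := [in x *: <<I>>]) (fun y => l y) xx) => a ax amin.
exists a, (a^-1 * x); split; rewrite ?mulKVg //; last first.
  by move: ax; rewrite mem_lcoset -groupV invMg invgK.
apply: coset_min_len => // c cI; apply: amin; move: ax.
by rewrite /= !mem_lcoset => ax; rewrite mulgA groupM.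
Qed.

(** [min_reps] asks only for ascents at single letters. Write [a = a0 * c0] with [a0] shortest in
    the coset: a last letter of [c0] would be a descent of [a], so [c0 = 1]. *)
Lemma min_rep_len I a c : I \subset S -> a \in min_reps S I -> c \in <<I>> ->
  l (a * c) = (l a + l c)%N.
Proof.
move=> IS /(min_repsP _ IS) aI; have [a0 [c0 [a0l c0I E]]] :=
  coset_min_exists a IS.
suff c01 : c0 = 1 by rewrite E c01 mulg1; apply: a0l.
have [w [wI rw c0w]] := gen_reduced IS c0I.
case/lastP: w => [|w s] in wI rw c0w; first by rewrite c0w big_nil.
move: wI; rewrite all_rcons => /andP[sI wI].
have [sS rw' lws] := reduced_rcons hS rw.
have c0s : c0 * s \in <<I>> by rewrite groupM // mem_gen.
have := aI s sI; rewrite E ltnNge -mulgA !a0l // leq_add2l.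
rewrite c0w -cats1 big_cat big_seq1 /= lws (coxKr hS) //.
by rewrite (proj2 rw') leqnSn.
Qed.

Lemma min_rep_exists I x : I \subset S -> exists a c,
  [/\ a \in min_reps S I, c \in <<I>>, x = a * c & l x = (l a + l c)%N].
Proof.
move=> IS; have [a [c [al cI E]]] := coset_min_exists x IS.
exists a, c; split; rewrite // ?E ?al //; apply/min_repsP => // s sI.
by rewrite al ?mem_gen // (len_gen hS (subsetP IS s sI)) addn1.
Qed.

Lemma min_rep_uniq I a a' : I \subset S -> a \in min_reps S I ->
  a' \in min_reps S I -> a^-1 * a' \in <<I>> -> a = a'.
Proof.
move=> IS aI a'I cI; suff /mulg1_eq : a^-1 * a' = 1 by rewrite invgK.
apply/eqP; rewrite -(len_eq0 hS).
have := min_rep_len IS aI cI; rewrite mulKVg.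
have := min_rep_len IS a'I (groupVr cI); rewrite invMg invgK mulKVg => ->.
by move=> /eqP; rewrite -addnA -{1}[l a']addn0 eqn_add2l eq_sym addn_eq0 =>
  /andP[].
Qed.

End Parabolic.

Lemma map_cons_split (T U : Type) (f : T -> U) v s v1 v2 :
  map f v = v1 ++ s :: v2 ->
  exists w1 w2 x, [/\ v = w1 ++ x :: w2, v1 = map f w1, v2 = map f w2 & s = f x].
Proof.
elim: v1 v => [|y v1 IHv] [|x v] //= [].
  by move=> <- <-; exists [::], v, x.
move=> <- /IHv[w1 [w2 [x' [-> -> -> ->]]]].
by exists (x :: w1), w2, x'.
Qed.

Lemma subseq_cat_split (T : eqType) (s x y : seq T) : subseq s (x ++ y) ->
  exists s1 s2, [/\ s = s1 ++ s2, subseq s1 x & subseq s2 y].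
Proof.
move=> /subseqP[m sm ->]; exists (mask (take (size x) m) x).
exists (mask (drop (size x) m) y); split; try exact: mask_subseq.
rewrite -mask_cat ?cat_take_drop // size_takel // sm size_cat.
exact: leq_addr.
Qed.

Lemma subseq_map_inv (T U : eqType) (f : T -> U) s v : subseq s (map f v) ->
  exists2 w, subseq w v & s = map f w.
Proof.
move=> /subseqP[m sm ->]; exists (mask m v); first exact: mask_subseq.
by rewrite map_mask.
Qed.

(** * Letters occurring in reduced words *)

Section Letters.

Local Open Scope group_scope.

Variables (G : groupType) (S : {pred G}).
Hypothesis hS : coxeter_system S.
Implicit Types (x y s t : G) (u v w : seq G).
Local Notation l := (cox_length S).
Local Notation wprod w := (\prod_(s <- w) s).

Lemma reduced_mem w w' : reduced S w -> all [in S] w' -> wprod w = wprod w' ->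
  {subset w <= w'}.
Proof.
move=> rw w'S E s sw; have sS : s \in S by apply: (allP (reduced_all rw)).
have : bruhat S s (wprod w').
  by rewrite -E -{1}[s]prod1w; apply: (subword_bruhat hS); rewrite ?sub1seq.
move=> /(bruhat_subword hS w'S)[v sub [rv E']]; apply: (mem_subseq sub).
by apply: (gen_mem_word hS sS (reduced_all rv)).
Qed.

(** A letter absent from a word always lengthens it: otherwise exchange would write [s w] as a
    subword of [w], and [letter_once] would find [s] in [w]. *)
Lemma reduced_uniq_cat u v : all [in S] u -> uniq u -> ~~ has [in u] v ->
  reduced S v -> reduced S (u ++ v).
Proof.
elim: u => //= s u IHu /andP[sS uS] /andP[su uu] dis rv.
have {IHu} rw : reduced S (u ++ v).
  apply: IHu => //; apply: contra dis => /hasP[t tv tu].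
  by apply/hasP; exists t; rewrite // inE tu orbT.
set w := u ++ v in rw *.
have sw : s \notin w.
  rewrite mem_cat negb_or su; apply: contra dis => sv.
  by apply/hasP; exists s; rewrite // mem_head.
split; first by rewrite /= sS (reduced_all rw).
rewrite big_cons (len_upl hS) // ?(proj2 rw) // -(proj2 rw) (lenSl hS) //.
apply/negP => /(strong_exchangel hS (refl_gen sS) (reduced_all rw)).
move=> [w1 [s' [w2 [wE E]]]].
have sub : subseq (w1 ++ w2) w by rewrite wE subseq_del.
have := @letter_once _ _ hS s [::] w (w1 ++ w2) sS (reduced_all rw).
rewrite /= big_cons E => /(_ (all_subseq sub (reduced_all rw)) erefl).
by rewrite mem_cat (negPf sw) /= => /(mem_subseq sub); apply/negP.
Qed.

Lemma reduced_cat_uniq u v : all [in S] u -> uniq u -> ~~ has [in u] v ->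
  reduced S v -> reduced S (v ++ u).
Proof.
move=> uS uu dis rv; rewrite -[v ++ u]revK rev_cat; apply: (reducedV hS).
apply: reduced_uniq_cat; rewrite ?all_rev ?rev_uniq ?has_rev //.
  by apply: contra dis => /hasP[s sv]; rewrite mem_rev => su; apply/hasP;
    exists s.
exact: reducedV.
Qed.

End Letters.

(** * Reduced words in What *)

Section Hat.

Local Open Scope group_scope.

Variables (W : finGroupType) (S : {set W}).
Hypothesis hS : coxeter_system S.
Variables (What : groupType) (Shat : {pred What}) (iota theta : W -> What).
Hypothesis hhat : is_hat_system S Shat iota theta.
Variables (n : nat) (r : 'I_n -> W).
Hypothesis r_inj : injective r.
Hypothesis rS : forall s : W, s \in S <-> exists i : 'I_n, s = r i.

Implicit Types (a b c g h k s : W) (I J : {set W}) (v w : seq W).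
Local Notation l := (cox_length S).
Local Notation lh := (cox_length Shat).
Local Notation wprod w := (\prod_(s <- w) s).
Local Notation z := (hat_z theta r).

Let hH : coxeter_system Shat := hat_coxeter hhat.

Lemma iotaM a b : iota (a * b) = iota a * iota b.
Proof. exact: (hat_iotaM hhat). Qed.

Lemma iota_inj : injective iota. Proof. exact: (hat_iota_inj hhat). Qed.

Lemma iota1 : iota 1 = 1.
Proof. by apply: (mulgI (iota 1)); rewrite -iotaM !mulg1. Qed.

Lemma iotaV a : iota a^-1 = (iota a)^-1.
Proof. by apply/esym/mulg1_eq; rewrite -iotaM mulgV iota1. Qed.

Lemma iota_prod w : iota (wprod w) = wprod (map iota w).
Proof. by elim: w => [|s w IH]; rewrite ?big_nil ?iota1 //=
  !big_cons iotaM IH. Qed.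

Lemma iota_word w : all [in S] w -> all [in Shat] (map iota w).
Proof.
by move=> wS; rewrite all_map; apply: sub_all wS => s; apply: (hat_iotaS hhat).
Qed.

(** Reducing the image word in [What] only drops letters, so the result is again the image of a word
    over [S], which represents the same element by injectivity of [iota]. *)
Lemma iota_reduced w : reduced S w -> reduced Shat (map iota w).
Proof.
move=> [wS lw]; have wH := iota_word wS; split=> //.
have [w' sub [rw' E]] := deletion hH wH.
have [v sv w'E] := subseq_map_inv sub.
rewrite -E (proj2 rw'); apply/eqP; rewrite eqn_leq size_subseq //=.
rewrite w'E !size_map -lw; suff -> : wprod w = wprod v.
  by rewrite len_le // (all_subseq sv).
by apply: iota_inj; rewrite !iota_prod -w'E.
Qed.

Lemma len_iota a : lh (iota a) = l a.
Proof.
have [w rw ->] := reduced_exists hS a.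
by rewrite iota_prod (proj2 (iota_reduced rw)) (proj2 rw) size_map.
Qed.

Lemma theta_gen s : s \in S -> theta s \in Shat.
Proof.
move=> sS; have [_ H] := hat_theta_image hhat (theta s).
by case: H => //; exists s.
Qed.

Lemma theta_iota s t : s \in S -> t \in S -> theta s <> iota t.
Proof.
move=> sS tS E; have [_ H] := hat_theta_image hhat (theta s).
by case: H => [|_ []]; [exists s | exists t].
Qed.

Lemma theta_commute s t : s \in S -> t \in S -> s != t ->
  commute (iota s) (theta t).
Proof.
move=> sS tS /eqP ne; apply: boolp.contrapT => nc.
exact: (ne ((hat_commute hhat sS tS).1 nc)).
Qed.

Definition zword I := [seq theta (r i) | i <- index_enum 'I_n & r i \notin I].

Lemma zwordE I : z I = wprod (zword I).
Proof. by rewrite big_map big_filter. Qed.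

Lemma rS_in i : r i \in S. Proof. by apply/rS; exists i. Qed.

Lemma zwordP I (t : What) :
  reflect (exists2 s, s \in S :\: I & t = theta s) (t \in zword I).
Proof.
apply: (iffP mapP) => [[i]|[s]].
  by rewrite mem_filter => /andP[riI _] ->; exists (r i); rewrite
    // inE riI rS_in.
rewrite inE => /andP[sI /rS[i sE]] ->; exists i; last by rewrite sE.
by rewrite mem_filter -sE sI mem_index_enum.
Qed.

Lemma mem_zword I s : s \in S -> (theta s \in zword I) = (s \notin I).
Proof.
move=> sS; apply/zwordP/idP => [[t]|sI]; last by exists s; rewrite // inE sI.
by rewrite inE => /andP[tI tS] /(hat_theta_inj hhat sS tS) ->.
Qed.

Lemma zword_uniq I : uniq (zword I).
Proof.
rewrite map_inj_in_uniq ?filter_uniq ?index_enum_uniq // => i j _ _.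
by move=> /(hat_theta_inj hhat (rS_in i) (rS_in j))/r_inj.
Qed.

Lemma zword_all I : all [in Shat] (zword I).
Proof.
by apply/allP=> _ /zwordP[s /setDP[sS _] ->]; apply: theta_gen.
Qed.

Lemma size_zword I : I \subset S -> (size (zword I) + #|I|)%N = #|S|.
Proof.
move=> IS; rewrite -(cardsID I S) (setIidPr IS) addnC; congr (_ + _)%N.
rewrite size_map -sum1_size big_filter sum1_card -(card_imset _ r_inj).
apply: eq_card => s; apply/imsetP/setDP => [[i riI ->]|[/rS[i ->] riI]].
  by rewrite rS_in.
by exists i.
Qed.

Lemma iota_notin_zword I s : s \in S -> iota s \notin zword I.
Proof.
move=> sS; apply/zwordP => -[t /setDP[tS _]] /esym; exact: theta_iota.
Qed.

Lemma zword_dis I w : all [in S] w -> ~~ has [in zword I] (map iota w).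
Proof.
move=> /allP wS; apply/hasP=> -[_ /mapP[s /wS sS ->]].
by apply/negP/iota_notin_zword.
Qed.

Lemma z_commute I c : I \subset S -> c \in <<I>> -> commute (iota c) (z I).
Proof.
move=> /subsetP IS /gen_wordP[w /allP wI ->].
elim: w wI => [|s w IHw] wI; first by rewrite big_nil iota1;
  apply: commute_sym; apply: commute1.
rewrite big_cons iotaM; apply: commute_sym; apply: commuteM; apply: commute_sym.
  have sI : s \in I by apply: wI; rewrite mem_head.
  apply: commute_prod => i riI.
  by apply: theta_commute; rewrite ?rS_in ?IS //; apply: contraNneq riI => <-.
by apply: IHw => t tw; apply: wI; rewrite inE tw orbT.
Qed.

(** Suppose [s] lies outside [I], so that [theta s] is a letter of [z_I]. The other letters commute
    with [s]; cancelling those after [theta s] makes [k] the conjugate of [s] by [u1 * theta s]. A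
    reduced word of [k] uses only letters of the resulting word, hence only [s]. So [k] is [1] or
    [s], which gives [s = 1] or lets [s] commute with [theta s]. *)
Lemma z_conj_gen I k s : I \subset S -> s \in S ->
  iota k * z I = z I * iota s -> s \in I.
Proof.
move=> IS sS E; apply: boolp.contrapT => /negP sI.
have /splitPr zE : theta s \in zword I by rewrite mem_zword.
move: E (zword_uniq I) (zword_all I); rewrite zwordE.
have letI (t : What) : t \in zword I -> t <> theta s -> commute (iota s) t.
  move=> /zwordP[t' /setDP[t'S _] -> ne]; apply: theta_commute => //.
  by apply: contra_notN ne => /eqP->.
have niota t : t \in S -> iota t \notin zword I by apply: iota_notin_zword.
case: zE letI niota => u1 u2 letI niota E; rewrite cat_uniq /=.
move=> /and3P[_ /norP[su1 _] /andP[su2 _]].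
rewrite all_cat /= => /and3P[u1H tH u2H].
have comU u : {subset u <= u1 ++ theta s :: u2} -> theta s \notin u ->
    commute (iota s) (wprod u).
  move=> sub su; elim: u sub su => [|t u IHu] sub;
    first by rewrite big_nil => _; apply: commute1.
  rewrite inE negb_or big_cons => /andP[ne su]; apply: commuteM.
    by apply: letI; [apply: sub; rewrite mem_head | apply/eqP; rewrite eq_sym].
  by apply: IHu su => t' tu; apply: sub; rewrite inE tu orbT.
have cu1 : commute (iota s) (wprod u1).
  by apply: comU => // t tu; rewrite mem_cat tu.
have cu2 : commute (iota s) (wprod u2).
  by apply: comU => // t tu; rewrite mem_cat inE tu !orbT.
have sH : iota s \in Shat by apply: (hat_iotaS hhat).
have {}E : iota k * wprod u1 * theta s = wprod u1 * theta s * iota s.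
  apply: (mulIg (wprod u2)); move: E; rewrite big_cat big_cons /= -!mulgA => ->.
  by rewrite cu2.
have kE : iota k = wprod (u1 ++ [:: theta s; iota s; theta s] ++ rev u1).
  rewrite !big_cat !big_cons big_nil /= mulg1 -(wprodV hH) //.
  by rewrite !mulgA -E (coxKr hH) // mulgK.
have [v rv kv] := reduced_exists hS k.
have vs : all (pred1 s) v.
  apply/allP=> t tv; have tS : t \in S by apply: (allP (reduced_all rv)).
  have : iota t \in u1 ++ [:: theta s; iota s; theta s] ++ rev u1.
    apply: (reduced_mem hH (iota_reduced rv)); last by rewrite map_f.
      by rewrite !all_cat /= all_rev u1H tH sH.
    by rewrite -iota_prod -kv.
  have := niota t tS; rewrite !mem_cat !inE mem_rev !negb_or.
  move=> /and3P[/negPf-> /negPf-> _]; rewrite /= !orbF.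
  by rewrite (inj_eq iota_inj).
have {vs} : k = 1 \/ k = s.
  rewrite {}kv; elim: v {rv} vs => [|t v IHv] /=; first by rewrite big_nil; left.
  move=> /andP[/eqP-> /IHv[] E1]; rewrite big_cons E1 ?mulg1; first by right.
  by left; apply: (cox_invol hS).
case=> kE1; move: E; rewrite kE1.
  rewrite iota1 mul1g -{1}[_ * theta s]mulg1 => /mulgI/esym.
  rewrite -iota1 => /iota_inj/eqP; apply/negP; exact: (cox_neq1 hS).
rewrite cu1 -!mulgA => /mulgI E1.
by case: ((hat_commute hhat sS sS).2 erefl).
Qed.

Lemma word_reduced_z I v : reduced S v -> reduced Shat (map iota v ++ zword I).
Proof.
move=> rv; apply: (reduced_cat_uniq hH).
- exact: zword_all.
- exact: zword_uniq.
- exact/zword_dis/reduced_all.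
- exact: iota_reduced.
Qed.

Lemma z_word_reduced I v : reduced S v -> reduced Shat (zword I ++ map iota v).
Proof.
move=> rv; apply: (reduced_uniq_cat hH).
- exact: zword_all.
- exact: zword_uniq.
- exact/zword_dis/reduced_all.
- exact: iota_reduced.
Qed.

(* In any word with the letters of W and exactly one occurrence of each letter
   of z I, no letter of z I can be deleted. *)
Lemma zword_letter I u1 t u2 v1 v2 w1 w2 : zword I = u1 ++ t :: u2 ->
  all [in S] v1 -> all [in S] v2 -> all [in S] w1 -> all [in S] w2 ->
  iota (wprod v1) * z I * iota (wprod v2) <>
  iota (wprod w1) * (wprod (u1 ++ u2)) * iota (wprod w2).
Proof.
move=> zE v1S v2S w1S w2S; rewrite zwordE !iota_prod zE -!big_cat /=.
rewrite -!catA /= catA => E.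
have := zword_uniq I; have := zword_all I; rewrite zE all_cat cat_uniq /=.
move=> /and3P[u1H tH u2H] /and3P[_ /norP[tu1 _] /andP[tu2 _]].
have := letter_once hH tH _ _ E; rewrite !all_cat u1H u2H !iota_word //=.
move=> /(_ isT isT).
have nt w : all [in S] w -> t \notin map iota w.
  move=> /allP wS; apply/mapP => -[s /wS sS tE].
  by have := iota_notin_zword I sS; rewrite zE -tE mem_cat mem_head orbT.
by rewrite !mem_cat (negPf tu1) (negPf tu2) !(negPf (nt _ _)).
Qed.

Lemma len_z_iota I h : lh (z I * iota h) = (size (zword I) + l h)%N.
Proof.
have [w rw ->] := reduced_exists hS h.
have [_] := z_word_reduced I rw.
by rewrite big_cat -zwordE -iota_prod size_cat size_map (proj2 rw).
Qed.

(** For a last letter [s] of [h], the product [g z_I s] is shorter than [g z_I]. Exchange cannot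
    touch [z_I], so it shortens [g] to some [g'] covered by the induction, and [g^-1 g' z_I = z_I s]
    is the case of one letter. *)
Lemma z_conj I g h : I \subset S -> iota g * z I = z I * iota h ->
  g \in <<I>>.
Proof.
move=> IS; have [w rw ->] := reduced_exists hS h.
elim/last_ind: w rw g => [|w s IHw] rw g.
  rewrite big_nil iota1 mulg1 -{2}[z I]mul1g => /mulIg.
  by rewrite -iota1 => /iota_inj ->; apply: group1.
have [sS rw' lws] := reduced_rcons hS rw.
rewrite -cats1 big_cat big_seq1 /= iotaM mulgA => E.
have Es : iota g * z I * iota s = z I * iota (wprod w).
  by rewrite E (coxKr hH) //; apply: (hat_iotaS hhat).
have [v rv gv] := reduced_exists hS g.
have lt : (lh (iota g * z I * iota s) < lh (iota g * z I))%N.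
  by rewrite Es E -mulgA -iotaM !len_z_iota lws (proj2 rw') addnS.
have := exchange_cat hH (v := map iota v) (w := zword I) (t := iota s).
rewrite -zwordE -iota_prod -gv Es => /(_ (refl_gen (hat_iotaS hhat sS))).
move=> /(_ (iota_word (reduced_all rv)) (zword_all I)); rewrite -Es => /(_ lt).
case=> [[v1 [s' [v2 [E0]]]]|].
  have [x1 [x2 [x [_ -> -> _]]]] := map_cons_split E0.
  rewrite -map_cat -iota_prod Es => /esym E1.
  have g'I := IHw rw' _ E1; set g' := wprod _ in E1 g'I.
  have E2 : iota (g^-1 * g') * z I = z I * iota s.
    by rewrite iotaM iotaV -mulgA E1 -Es -mulgA mulKg.
  have sI := z_conj_gen IS sS E2; move: E2.
  rewrite -(z_commute IS (mem_gen sI)) => /mulIg/iota_inj E2.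
  have -> : g = g' * s^-1 by rewrite -E2 invMg invgK mulKVg.
  by rewrite groupM // groupV mem_gen.
move=> [u1 [t [u2 [zE E1]]]]; exfalso.
apply: (@zword_letter I u1 t u2 [::] [:: s] [::] [::] zE) => //=.
  by rewrite sS.
by rewrite !big_nil big_seq1 !iota1 !mul1g mulg1.
Qed.

Lemma len_az I a : lh (iota a * z I) = (l a + size (zword I))%N.
Proof.
have [w rw ->] := reduced_exists hS a.
have [_] := word_reduced_z I rw.
by rewrite big_cat -zwordE -iota_prod size_cat size_map (proj2 rw).
Qed.

(** Were a letter of [b] not to lengthen the product, exchange would delete a letter of [a], of
    [z_I] or of [b]. In the first case [z_conj] puts the shortened [a'] into the coset [a W_I],
    against minimality of [a]; [zword_letter] excludes the second, and reducedness of the word of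
    [b] the third. *)
Lemma len_azb I a b : I \subset S -> a \in min_reps S I ->
  lh (iota a * z I * iota b) = (l a + size (zword I) + l b)%N.
Proof.
move=> IS aI; have [w rw ->] := reduced_exists hS b.
elim/last_ind: w rw => [|w s IHw] rw.
  by rewrite big_nil iota1 mulg1 len1 addn0 len_az.
have [sS rw' lws] := reduced_rcons hS rw; have {}IHw := IHw rw'.
have sH : iota s \in Shat by apply: (hat_iotaS hhat).
rewrite -cats1 big_cat big_seq1 /= lws iotaM mulgA addnS -(proj2 rw') -IHw.
apply: (len_upr hH sH); rewrite (lenSr hH _ sH); apply/negP.
have [v rv av] := reduced_exists hS a; have rvz := word_reduced_z I rv.
rewrite av (iota_prod v) (iota_prod w) zwordE -big_cat.
move=> /(exchange_cat hH (refl_gen sH) (reduced_all rvz)).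
move=> /(_ (iota_word (reduced_all rw')))[].
  move=> [v1 [t [v2 [E0]]]]; have [[v3 [E1 ->]]|[u1 [-> zE]]] :=
    cat_cons_split E0.
    have [x1 [x2 [x [vE -> -> _]]]] := map_cons_split E1.
    rewrite catA -map_cat !big_cat -zwordE -!iota_prod -av -mulgA -iotaM.
    set a' := wprod (x1 ++ x2) => /= E.
    have /(z_conj IS) aa' : iota (a'^-1 * a) * z I =
        z I * iota (wprod w * (wprod w * s)^-1).
      rewrite [in LHS]iotaM iotaV -mulgA; apply: (mulgI (iota a')).
      rewrite mulKVg mulgA; apply: (mulIg (iota (wprod w * s))).
      by rewrite E -[RHS]mulgA -iotaM mulgVK.
    have := min_rep_len hS IS aI (groupVr aa'); rewrite invMg invgK mulKVg.
    apply/eqP; rewrite neq_ltn (leq_trans _ (leq_addr _ _)) //.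
    by rewrite /a' av vE len_del // -vE.
  move=> E; have := @zword_letter I u1 t v2 v (rcons w s) v w zE.
  case; rewrite ?(reduced_all rv) ?(reduced_all rw) ?(reduced_all rw') //.
  move: E; rewrite -cats1 !big_cat big_seq1 /= -zwordE -!iota_prod !iotaM.
  by rewrite !mulgA.
move=> [w1 [t [w2 [E0]]]].
have [x1 [x2 [x [wE -> -> _]]]] := map_cons_split E0.
rewrite -map_cat -!iota_prod -iotaM => /iota_inj E.
have := len_del (S := S) (s := x) (w1 := x1) (w2 := x2).
by rewrite -wE -E => /(_ rw'); rewrite lws (proj2 rw') ltnNge ltnW.
Qed.

(** A letter [theta s] occurring once on one side must occur on the other by [letter_once], whence
    [I = J]. Then [z_conj] puts [a] and [a'] into the same coset of [W_I]. *)
Lemma azb_uniq I J a b a' b' : I \subset S -> J \subset S ->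
  a \in min_reps S I -> a' \in min_reps S J ->
  iota a * z I * iota b = iota a' * z J * iota b' -> [/\ I = J, a = a' & b = b'].
Proof.
have sub (K L : {set W}) (c d c' d' : W) : L \subset S ->
    iota c * z K * iota d = iota c' * z L * iota d' -> L \subset K.
  move=> /subsetP LS E; apply/subsetP => s sL; apply/negPn/negP => sK.
  have sS := LS s sL; have /splitPr zE : theta s \in zword K by rewrite mem_zword.
  have [v rv cv] := reduced_exists hS c; have [w rw dw] := reduced_exists hS d.
  have [v' rv' cv'] := reduced_exists hS c'; have [w' rw' dw'] :=
    reduced_exists hS d'.
  have zLs : theta s \notin zword L by rewrite mem_zword // sL.
  have := zword_all K; have := zword_uniq K; move: E; rewrite cv dw cv' dw'.
  rewrite !iota_prod !zwordE; case: zE => u1 u2 E; rewrite cat_uniq /=.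
  move=> /and3P[_ /norP[su1 _] /andP[su2 _]]; rewrite all_cat /=.
  move=> /and3P[u1H tH u2H].
  have nt x : all [in S] x -> theta s \notin map iota x.
    move=> /allP xS; apply/mapP => -[t /xS tS]; exact: theta_iota.
  have := @letter_once _ _ hH _ (map iota v ++ u1) (u2 ++ map iota w)
    (map iota v' ++ zword L ++ map iota w') tH.
  rewrite !all_cat u1H u2H zword_all !iota_word ?reduced_all //= => /(_ isT isT).
  move: E; rewrite -!big_cat -!catA /= => E /(_ E).
  by rewrite !mem_cat (negPf su1) (negPf su2) (negPf zLs) !(negPf (nt _ _))
    ?reduced_all.
move=> IS JS aI a'J E; have eIJ : I = J.
  by apply/eqP;
    rewrite eqEsubset (sub _ _ _ _ _ _ JS E) (sub _ _ _ _ _ _ IS (esym E)).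
move: a'J E; rewrite -{J JS}eIJ => a'I E.
have aa' : a'^-1 * a \in <<I>>.
  apply: (z_conj (h := b' * b^-1)) => //.
  apply: (mulgI (iota a')); apply: (mulIg (iota b)).
  by rewrite !iotaM !iotaV !mulgA mulgV mul1g E mulgVK.
have aE := min_rep_uniq hS IS a'I aI aa'.
by split=> //; apply: iota_inj; move: E; rewrite aE => /mulgI.
Qed.

Lemma zword_sub I J : I \subset J -> subseq (zword J) (zword I).
Proof.
move=> /subsetP IJ; apply: map_subseq.
rewrite subseq_filter filter_subseq andbT; apply/allP => i.
by rewrite mem_filter => /andP[riJ _]; apply: contra riJ; apply: IJ.
Qed.

Lemma zword_reduced I : reduced Shat (zword I).
Proof.
have r0 : reduced S [::] by split; rewrite // big_nil len1.
by have := word_reduced_z I r0.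
Qed.

Lemma zword_subseq I (w : seq What) : subseq w (zword I) -> 
  exists J, [/\ J \subset S, S :&: I \subset J & w = zword J].
Proof.
move=> /subseq_map_inv[q sub ->].
exists (S :\: [set r i | i in q]); split; first exact: subsetDl.
  apply/subsetP => _ /setIP[/rS[i ->] riI]; rewrite !inE rS_in andbT.
  apply/imsetP => -[j jq /r_inj ij]; have := mem_subseq sub jq.
  by rewrite mem_filter -ij riI.
have subi : subseq q (index_enum 'I_n).
  by apply: subseq_trans sub _; apply: filter_subseq.
(* A subsequence of a duplicate-free list is its filter by membership, hence determined by its set
   of entries; this keeps the fixed order of the letters. *)
have qE := elimT (subseq_uniqP (index_enum_uniq _)) subi.
rewrite {1}qE; congr map; apply: eq_filter => i; rewrite !inE rS_in andbT negbK.
by apply/idP/imsetP => [iq|[j jq /r_inj->] //]; exists i.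
Qed.

Lemma bruhat_iota a b : bruhat S a b -> bruhat Shat (iota a) (iota b).
Proof.
elim=> [|{}b t _ IH [s [g [sS ->]]] lt]; first exact: bruhat_refl.
rewrite iotaM; apply: bruhat_step => //; last by rewrite -iotaM !len_iota.
exists (iota s), (iota g); split; first exact: (hat_iotaS hhat).
by rewrite /conjg !iotaM iotaV.
Qed.

Lemma azb_le I J a b a' b' : I \subset S -> a \in min_reps S I ->
  I \subset J -> bruhat S a' a -> bruhat S b' b ->
  bruhat Shat (iota a' * z J * iota b') (iota a * z I * iota b).
Proof.
move=> IS aI IJ a'a b'b.
apply: (bruhat_cat hH); last exact: bruhat_iota.
  by rewrite len_azb // len_az len_iota.
apply: (bruhat_cat hH); last by rewrite !zwordE;
  apply: (subword_bruhat hH (zword_reduced I)); apply: zword_sub.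
  by rewrite len_az len_iota zwordE (proj2 (zword_reduced I)).
exact: bruhat_iota.
Qed.

(** A reduced subword splits into blocks from [a], [z_I] and [b], each again reduced, whence the
    length formula. The element [a'] need not lie in [W^J]; [phi_below] repairs that. *)
Lemma azb_below I a b x : I \subset S -> a \in min_reps S I ->
  bruhat Shat x (iota a * z I * iota b) ->
  exists a' J b', [/\ J \subset S, I \subset J, bruhat S a' a, bruhat S b' b &
    x = iota a' * z J * iota b' /\
    lh x = (l a' + size (zword J) + l b')%N].
Proof.
move=> IS aI; have [v rv av] := reduced_exists hS a.
have [w rw bw] := reduced_exists hS b.
have E : iota a * z I * iota b = wprod ((map iota v ++ zword I) ++ map iota w).
  by rewrite !big_cat -zwordE -!iota_prod -av -bw.
rewrite E => /(bruhat_subword hH)[].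
  by rewrite !all_cat zword_all (iota_word (reduced_all rv)) (iota_word (reduced_all rw)).
move=> x' /subseq_cat_split[y [x3 [-> /subseq_cat_split[x1 [x2 [-> s1 s2]]] s3]]].
have [v' sv x1E] := subseq_map_inv s1; have [w' sw x3E] := subseq_map_inv s3.
have [J [JS IJ x2E]] := zword_subseq s2.
move=> [rx xE].
have v'S : all [in S] v' := all_subseq sv (reduced_all rv).
have w'S : all [in S] w' := all_subseq sw (reduced_all rw).
have unred u : all [in S] u -> reduced Shat (map iota u) -> l (wprod u) = size u.
  by move=> uS [_]; rewrite -iota_prod len_iota size_map.
have r12 := reduced_catl hH rx.
exists (wprod v'), J, (wprod w'); split=> //.
- by apply: subset_trans IJ; rewrite (setIidPr IS).
- by rewrite av; apply: (subword_bruhat hS).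
- by rewrite bw; apply: (subword_bruhat hS).
rewrite -xE (proj2 rx) !big_cat !size_cat x1E x2E x3E !iota_prod -!zwordE.
split=> //; rewrite !size_map !unred //.
  by rewrite -x3E; apply: (reduced_catr hH rx).
by rewrite -x1E; apply: (reduced_catl hH r12).
Qed.

End Hat.

(** * The order isomorphism *)

Section Phi.

Local Open Scope group_scope.

Variables (W : finGroupType) (S : {set W}).
Hypothesis hS : coxeter_system S.
Variable wS : W.
Hypothesis hwS : forall x : W, (cox_length S x <= cox_length S wS)%N.
Variables (What : groupType) (Shat : {pred What}) (iota theta : W -> What).
Hypothesis hhat : is_hat_system S Shat iota theta.
Variables (n : nat) (r : 'I_n -> W).
Hypothesis r_inj : injective r.
Hypothesis rS : forall s : W, s \in S <-> exists i : 'I_n, s = r i.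

Implicit Types (a b c s t : W) (I J : {set W}) (v w : V S).
Local Notation l := (cox_length S).
Local Notation lh := (cox_length Shat).
Local Notation z := (hat_z theta r).
Local Notation phi' := (@phi W S What iota theta n r wS).

Lemma vIP v : vI v \subset S. Proof. by case/andP: (VtripleP v). Qed.
Lemma vaP v : va v \in min_reps S (vI v). Proof. by case/andP: (VtripleP v). Qed.

Lemma V_eq v w : vI v = vI w -> va v = va w -> vb v = vb w -> v = w.
Proof.
rewrite /vI /va /vb => EI Ea Eb; apply: val_inj; move: EI Ea Eb => /=.
by case: (Vtriple v) (Vtriple w) => [[I a] b] [[J a'] b'] /= -> -> ->.
Qed.

Lemma V_exists I a b : I \subset S -> a \in min_reps S I ->
  exists v : V S, [/\ vI v = I, va v = a & vb v = b].
Proof.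
move=> IS aI; have P : (I \subset S) && (a \in min_reps S I) by rewrite IS.
by exists (MkV (Vtriple := (I, a, b)) P).
Qed.

Lemma phiE v : phi' v = iota (va v) * z (vI v) * iota ((vb v)^-1 * wS).
Proof. by rewrite /phi (iotaM hhat) (iotaV hhat) mulgA. Qed.

Lemma phi_triple I a b v : vI v = I -> va v = a -> vb v = wS * b^-1 ->
  phi' v = iota a * z I * iota b.
Proof. by move=> <- <- E; rewrite phiE E invMg invgK mulgVK. Qed.

Lemma phi_lenD v :
  (lh (phi' v) + l (vb v) + #|vI v| = l (va v) + #|S| + l wS)%N.
Proof.
rewrite phiE (len_azb hS hhat r_inj rS _ (vIP v) (vaP v)).
have := size_zword theta r_inj rS (vIP v).
have : (l ((vb v)^-1 * wS) + l (vb v))%N = l wS := longest_lenV hS hwS (vb v).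
by lia.
Qed.

Lemma phi_len v : ((lh (phi' v))%:Z = - Vdim v + #|S|%:Z + (l wS)%:Z)%R.
Proof. by have := phi_lenD v; rewrite /Vdim; lia. Qed.

Lemma phi_inj : injective phi'.
Proof.
move=> v w; rewrite !phiE => E.
have [EI Ea Eb] := azb_uniq hS hhat r_inj rS (vIP v) (vIP w) (vaP v) (vaP w) E.
by apply: V_eq => //; move: Eb => /mulIg/invg_inj.
Qed.

Lemma le_longest x : bruhat S x wS.
Proof.
have b1 y : bruhat S 1 y.
  have [w rw ->] := reduced_exists hS y.
  by have := subword_bruhat hS rw (sub0seq w); rewrite big_nil.
have := longest_antil hS hwS (b1 (wS * x)).
by rewrite mulg1 mulgA (longest_invol hS hwS) mul1g.
Qed.

Lemma min_reps0 a : a \in min_reps S set0.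
Proof. by apply/(min_repsP hS _ (sub0set S)) => s; rewrite inE. Qed.

(** Split [a'] as [a1 * c] with [a1] in [W^J] and [c] in [W_J], and move [c] across [z_J]. Comparing
    the length of [x] from its reduced subword with [len_azb] shows that lengths add in [c * b']. *)
Lemma phi_below x I a b : I \subset S -> a \in min_reps S I ->
  bruhat Shat x (iota a * z I * iota b) ->
  exists v c d, [/\ x = phi' v, I \subset vI v, c \in <<vI v>>,
    bruhat S (va v * c) a & bruhat S d b] /\
   (l (c * d) = (l c + l d)%N /\ vb v = wS * (c * d)^-1).
Proof.
move=> IS aI.
move=> /(azb_below hS hhat r_inj rS IS aI)[a' [J [b' [JS IJ a'a b'b [xE lx]]]]].
have [a1 [c [a1J cJ a'E la']]] := min_rep_exists hS a' JS.
have {}xE : x = iota a1 * z J * iota (c * b').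
  rewrite xE a'E !(iotaM hhat) -(mulgA (iota a1)).
  by rewrite (z_commute hhat rS JS cJ) !mulgA.
have [v [EI Ea Eb]] := V_exists (wS * (c * b')^-1) JS a1J.
exists v, c, b'; rewrite EI Ea Eb -a'E; split; split=> //.
  by rewrite (phi_triple EI Ea Eb).
apply/eqP; rewrite -(eqn_add2l (l a1 + size (zword theta r J))).
rewrite -(len_azb hS hhat r_inj rS _ JS a1J) -xE lx la'; apply/eqP; lia.
Qed.

Lemma phi_interval x :
  bruhat Shat x (iota wS * z set0 * iota wS) <-> exists v, x = phi' v.
Proof.
split=> [/(phi_below (sub0set S) (min_reps0 wS))[v [c [d [[-> _ _ _ _] _]]]]|].
  by exists v.
move=> [v ->]; rewrite phiE.
apply: (azb_le hS hhat r_inj rS (sub0set S) (min_reps0 wS) (sub0set _));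
  exact: le_longest.
Qed.

Lemma Vle_phi v w : Vle v w -> bruhat Shat (phi' w) (phi' v).
Proof.
elim=> {v w} [v w [[IJ aa bb]|[IJ [c [cJ bE lb aa]]]]|v|v1 v2 v3 _ b12 _ b23].
- rewrite !phiE; apply: (azb_le hS hhat r_inj rS (vIP v) (vaP v) IJ aa).
  by apply/(longest_antir hS hwS)/(bruhatV hS).
(* Since [(vb w)^-1 = c * (vb v)^-1], moving [c] to the left across [z] gives both images the same
   right factor. *)
- have -> : phi' w = iota (va w * c) * z (vI w) * iota ((vb v)^-1 * wS).
    rewrite phiE bE (iotaM hhat (va w)) -(mulgA (iota (va w)) (iota c)).
    rewrite (z_commute hhat rS (vIP w) cJ) mulgA -[RHS]mulgA -(iotaM hhat c).
    by congr (_ * iota _); rewrite invMg !mulgA mulgV mul1g.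
  rewrite phiE; apply: (azb_le hS hhat r_inj rS (vIP v) (vaP v) IJ aa).
  exact: bruhat_refl.
- exact: bruhat_refl.
- exact: bruhat_trans b23 b12.
Qed.

Lemma phi_Vle v w : bruhat Shat (phi' w) (phi' v) -> Vle v w.
Proof.
rewrite [phi' v]phiE => /(phi_below (vIP v) (vaP v)).
move=> [w' [c [d [[/phi_inj<- IJ cJ aa bb] [lcd bE]]]]].
(* The intermediate element differs from [v] only in its last entry: every relation is one step of
   [Vle1] followed by one step of [Vle2]. *)
have [v' [EI Ea Eb]] := V_exists (wS * d^-1) (vIP v) (vaP v).
apply: (rt_trans _ _ _ v'); apply: rt_step.
  left; split; rewrite ?EI ?Ea ?Eb //; first exact: bruhat_refl.
  have := longest_antir hS hwS bb; rewrite -mulgA (longest_invol hS hwS) mulg1.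
  by move=> /(bruhatV hS); rewrite invMg invgK (longestV hS hwS).
right; split; first by rewrite EI.
exists c; split=> //; last by rewrite Ea.
  by rewrite Eb bE invMg mulgA mulgVK.
rewrite Eb bE.
have : (l (wS * d^-1) + l d)%N = l wS.
  by rewrite -(longest_lenr hS hwS d^-1) (lenV hS).
have : (l (wS * (c * d)^-1) + l (c * d))%N = l wS.
  by rewrite -(longest_lenr hS hwS (c * d)^-1) (lenV hS).
by rewrite lcd; lia.
Qed.

Variable act : W * W -> V S -> V S.
Hypothesis hact : is_Vaction act.

Lemma phi_act_right s v : s \in S ->
  phi' (act (1, s) v) = phi' v * iota (wS * s * wS).
Proof.
move=> sS; have := Vact_right hact v sS.
move E: (act _ v) => w Ew; have [EI Ea Eb] :
  [/\ vI w = vI v, va w = va v & vb w = s * vb v].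
  by rewrite /vI /va /vb Ew.
rewrite !phiE EI Ea Eb -[RHS]mulgA -(iotaM hhat); congr (_ * iota _).
by rewrite invMg (coxV hS sS)
  !mulgA -[_ * wS * wS]mulgA (longest_invol hS hwS) mulg1.
Qed.

(** Deodhar's lemma: some [t] in [I] is a descent of [s a] but not of [a], and [square_eq] then
    gives [s a = a t]. *)
Lemma min_reps_shift s v : s \in S -> s * va v \notin min_reps S (vI v) ->
  exists2 t, t \in vI v & bruhat S (va v) (s * va v) /\ s * va v = va v * t.
Proof.
move=> sS; set I := vI v; set a := va v; have IS : I \subset S := vIP v.
move=> nI; have [t tI] : exists2 t, t \in I & (l (s * a * t) < l (s * a))%N.
  apply: boolp.contrapT => nt; move/negP: nI; apply.
  apply/(min_repsP hS _ IS) => t tI; rewrite (lenSr hS) ?(subsetP IS) //.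
  by apply/negP => lt; apply: nt; exists t.
have tS := subsetP IS t tI.
have aI := (min_repsP hS a IS (vaP v)) t tI.
move=> /(square_eq hS sS tS aI) E; exists t => //; split=> //.
by apply/(bruhat_genl hS _ sS); rewrite E.
Qed.

Lemma phi_act_left s v : s \in S -> phi' (act (s, 1) v) = iota s * phi' v.
Proof.
move=> sS; have [saI|/(min_reps_shift sS)[t tI [lea sat]]] :=
  boolP (s * va v \in min_reps S (vI v)).
  have := Vact_left_min hact sS saI; move E: (act _ v) => w Ew.
  have [EI Ea Eb] : [/\ vI w = vI v, va w = s * va v & vb w = vb v].
    by rewrite /vI /va /vb Ew.
  by rewrite !phiE EI Ea Eb (iotaM hhat s) !mulgA.
have := Vact_left_par hact sS tI lea sat; move E: (act _ v) => w Ew.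
have [EI Ea Eb] : [/\ vI w = vI v, va w = va v & vb w = vb v * t].
  by rewrite /vI /va /vb Ew.
have tS := subsetP (vIP v) t tI.
rewrite !phiE EI Ea Eb !mulgA -(iotaM hhat) sat (iotaM hhat).
rewrite -[_ * iota t * _]mulgA (z_commute hhat rS (vIP v) (mem_gen tI)).
by rewrite invMg (coxV hS tS) -[t * _ * _]mulgA (iotaM hhat t) !mulgA.
Qed.

Lemma phi_act x y v : phi' (act (x, y) v) =
  iota x * phi' v * iota wS * (iota y)^-1 * iota wS.
Proof.
have -> : (x, y) = (x, 1) * (1, y) :> W * W.
  by transitivity (x * 1, 1 * y) => //; rewrite mulg1 mul1g.
rewrite (VactM hact).
have right (w : seq W) :
  all [in S] w -> forall v, phi' (act (1, \prod_(s <- w) s) v) =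
    phi' v * iota wS * (iota (\prod_(s <- w) s))^-1 * iota wS.
  elim: w => [_ u|s w IHw /andP[sS wwS] u].
    rewrite big_nil (Vact1 hact) (iota1 hhat) invg1 mulg1 -mulgA -(iotaM hhat).
    by rewrite (longest_invol hS hwS) (iota1 hhat) mulg1.
  have -> : (1, \prod_(t <- s :: w) t) = (1, s) * (1, \prod_(t <- w) t) :> W * W.
    transitivity (1 * 1 : W, s * \prod_(t <- w) t) => //.
    by rewrite mul1g big_cons.
  rewrite (VactM hact) (phi_act_right _ sS) (IHw wwS) big_cons.
  rewrite !(iotaM hhat) invMg -(iotaV hhat s) (coxV hS sS) !mulgA.
  by rewrite -[_ * iota wS * iota wS]mulgA -(iotaM hhat wS) (longest_invol hS hwS)
     (iota1 hhat) mulg1.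
have left (w : seq W) :
  all [in S] w -> forall v, phi' (act (\prod_(s <- w) s, 1) v) =
    iota (\prod_(s <- w) s) * phi' v.
  elim: w => [_ u|s w IHw /andP[sS wwS] u].
    by rewrite big_nil (Vact1 hact) (iota1 hhat) mul1g.
  have -> : (\prod_(t <- s :: w) t, 1) = (s, 1) * (\prod_(t <- w) t, 1) :> W * W.
    transitivity (s * \prod_(t <- w) t, 1 * 1 : W) => //.
    by rewrite mul1g big_cons.
  by rewrite (VactM hact) (phi_act_left _ sS) (IHw wwS) big_cons (iotaM hhat) mulgA.
have [wx rx ->] := reduced_exists hS x; have [wy ry ->] := reduced_exists hS y.
by rewrite (left _ (reduced_all rx)) (right _ (reduced_all ry)) !mulgA.
Qed.

End Phi.

Section NewLetter.

Local Open Scope group_scope.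

Variables (G : groupType) (S : {pred G}).
Hypothesis hS : coxeter_system S.
Implicit Types (t : G) (v w : seq G).
Local Notation wprod w := (\prod_(s <- w) s).

Lemma new_letter_nle v w t : all [in S] v -> all [in S] w -> t \in S ->
  t \notin v -> t \notin w -> ~ bruhat S (wprod v * t) (wprod w).
Proof.
move=> vS wS tS tv tw /(bruhat_subword hS wS)[w' sub [rw' E]].
have := @letter_once _ _ hS t v [::] w' tS.
rewrite cats0 cats1 big_rcons vS (reduced_all rw') => /(_ isT isT (esym E)).
rewrite mem_cat (negPf tv) /= => /(mem_subseq sub); exact/negP.
Qed.

Lemma new_letter_len w t : all [in S] w -> t \in S -> t \notin w ->
  (cox_length S (wprod w) < cox_length S (wprod w * t))%N.
Proof.
move=> wS tS tw; rewrite (lenSr hS _ tS); apply/negP => lt.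
apply: (new_letter_nle wS wS tS tw tw).
rewrite -{2}[wprod w](coxKr hS _ tS); apply: bruhat_lt; first exact: refl_gen.
by rewrite (coxKr hS _ tS).
Qed.

End NewLetter.

(** * Springer's matrix *)

Section Springer.

Local Open Scope group_scope.

Import Order.TTheory.

Variables (W : finGroupType) (S : {set W}).
Hypothesis hS : coxeter_system S.
Variable wS : W.
Hypothesis hwS : forall x : W, (cox_length S x <= cox_length S wS)%N.
Variables (What : groupType) (Shat : {pred What}) (iota theta : W -> What).
Hypothesis hhat : is_hat_system S Shat iota theta.
Variables (n : nat) (r : 'I_n -> W).
Hypothesis r_inj : injective r.
Hypothesis rS : forall s : W, s \in S <-> exists i : 'I_n, s = r i.
Variable act : W * W -> V S -> V S.
Hypothesis hact : is_Vaction act.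
Variable RW : W -> W -> {poly int}.
Hypothesis hRW : is_R_polynomials S RW.
Variable R : What -> What -> {poly int}.
Hypothesis hR : is_R_polynomials Shat R.

Implicit Types (a b c g s t : W) (I J : {set W}) (v w : V S).
Local Notation l := (cox_length S).
Local Notation lh := (cox_length Shat).
Local Notation z := (hat_z theta r).
Local Notation wprod w := (\prod_(s <- w) s).
Local Notation phi' := (@phi W S What iota theta n r wS).
Local Notation rho := (Rtilde Shat R).
Local Notation beta := (bar alpha).

Let hH : coxeter_system Shat := hat_coxeter hhat.

Lemma Rtilde_iota a b : rho (iota a) (iota b) = Rtilde S RW a b.
Proof.
have [w rw ->] := reduced_exists hS b.
elim: w rw a => [|s w IHw] rw a.
  rewrite big_nil (iota1 hhat) (Rtilde_1 hH hR) (Rtilde_1 hS hRW).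
  by rewrite -(iota1 hhat) (inj_eq (iota_inj hhat)).
have [sS rw' lt] := reduced_cons hS rw; rewrite big_cons.
rewrite (Rtilde_l hS hRW a sS lt) (iotaM hhat) (Rtilde_l hH hR).
- by rewrite -(iotaM hhat) !IHw // !(len_iota hS hhat).
- exact: (hat_iotaS hhat).
by rewrite -(iotaM hhat) !(len_iota hS hhat).
Qed.

(** Letters are removed from the right, hence the partial products [p L]. A letter outside [J]
    occurs in both elements and is stripped. One in [J] but not in [I] occurs only in the second and
    contributes [beta]; the other term of the recursion vanishes because a letter absent from a word
    cannot appear below it. *)
Lemma Rtilde_peel I J g a : I \subset J -> J \subset S ->
  rho (iota g * z J) (iota a * z I) =
  (beta ^+ (#|J| - #|I|) * Rtilde S RW g a)%R.
Proof.
move=> IJ JS; pose p (L : seq 'I_n) (K : {set W}) :=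
  wprod [seq theta (r i) | i <- L & r i \notin K].
suff peel L : uniq L -> rho (iota g * p L J) (iota a * p L I) =
    (beta ^+ count [pred i | r i \in J :\: I] L * Rtilde S RW g a)%R.
  rewrite !zwordE -[zword _ _ J]/(map _ _) -[zword _ _ I]/(map _ _).
  rewrite -![wprod _]/(p _ _) peel ?index_enum_uniq //; congr (_ ^+ _ * _)%R.
  rewrite -sum1_count sum1_card -(card_imset _ r_inj) -{2}(setIidPr IJ) -cardsD.
  apply: eq_card => s; apply/imsetP/idP => [[i iJI ->] //|sJI].
  have /rS[i sE] : s \in S by move: sJI => /setDP[/(subsetP JS)].
  by exists i; rewrite // unfold_in /= -sE.
have pcat i (M : seq 'I_n) (K : {set W}) :
  p (rcons M i) K = p M K * (if r i \notin K then theta (r i) else 1).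
  rewrite /p filter_rcons; case: ifP => _; last by rewrite mulg1.
  by rewrite map_rcons big_rcons.
elim/last_ind: L => [_|L i IHL].
  by rewrite /p /= !big_nil !mulg1 expr0 mul1r Rtilde_iota.
rewrite rcons_uniq => /andP[iL uL]; have {}IHL := IHL uL.
set t := theta (r i); have tH : t \in Shat by apply/(theta_gen hhat)/rS_in.
have word c (K : {set W}) :
  exists u, [/\ all [in Shat] u, t \notin u & iota c * p L K = wprod u].
  have [u ru ->] := reduced_exists hS c.
  exists (map iota u ++ [seq theta (r i) | i <- L & r i \notin K]); split.
  - rewrite all_cat (iota_word hhat (reduced_all ru)) /=.
    by apply/allP => _ /mapP[j _ ->]; apply/(theta_gen hhat)/rS_in.
  - rewrite mem_cat negb_or; apply/andP; split.
      apply/mapP => -[s su]; apply: (theta_iota hhat (rS_in rS i)).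
      exact: (allP (reduced_all ru)).
    apply/mapP => -[j]; rewrite mem_filter => /andP[_ jL].
    move/(hat_theta_inj hhat (rS_in rS i) (rS_in rS j))/r_inj => ij.
    by move: iL; rewrite ij jL.
  by rewrite big_cat /= (iota_prod hhat).
have [u [uH tu uE]] := word g J; have [w [wH tw wE]] := word a I.
rewrite !pcat -cats1 count_cat /= addn0 inE.
have ltu : (lh (iota g * p L J) < lh (iota g * p L J * t))%N.
  by rewrite uE; apply: new_letter_len.
have ltw : (lh (iota a * p L I) < lh (iota a * p L I * t))%N.
  by rewrite wE; apply: new_letter_len.
case: (boolP (r i \in I)) => [iI|iI]; first by rewrite (subsetP IJ)
  //= mulg1 addn0 mulg1.
case: (boolP (r i \in J)) => [iJ|iJ] /=; rewrite !mulgA.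
  rewrite mulg1 (Rtilde_r hH hR _ tH ltw) ltu IHL addn1 exprS mulrA.
  rewrite (Rtilde_eq0 hH hR) ?add0r // uE wE.
  exact: new_letter_nle.
by rewrite (Rtilde_rr hH hR tH ltu ltw) IHL addn0.
Qed.

Lemma Rtilde_phi_base w v : vb v = 1 ->
  rho (phi' v) (phi' w) =
  if (vI w \subset vI v) && (vb w \in <<vI v>>)
  then (beta ^+ (#|vI v| - #|vI w|) * Rtilde S RW (va v * vb w) (va w))%R
  else 0%R.
Proof.
move=> v1; rewrite !(phiE _ hhat) v1 invg1 mul1g.
set c := (vb w)^-1 * wS.
have lc : (l (vb w) + l c)%N = l wS.
  by rewrite addnC; apply: (longest_lenV hS hwS (vb w)).
have lcH : lh (iota c) = l c := len_iota hS hhat c.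
(* Both elements now end in [c] with additive lengths, so [Rtilde_cat] removes it. *)
have -> : iota wS = iota (vb w) * iota c by rewrite -(iotaM hhat) mulKVg.
rewrite mulgA (Rtilde_cat hH hR) ?lcH; first last.
- by rewrite (len_azb hS hhat r_inj rS _ (vIP w) (vaP w)) (len_az hS hhat r_inj rS).
- rewrite -mulgA -(iotaM hhat) mulKVg
  !(len_azb hS hhat r_inj rS _ (vIP v) (vaP v)).
  by rewrite -lc addnA.
case: ifP => [/andP[IJ cJ]|/negP nP].
  rewrite -mulgA -(z_commute hhat rS (vIP v) cJ) mulgA -(iotaM hhat).
  by rewrite Rtilde_peel // vIP.
(* [phi_below] is used with right factor [1], so its remainder [e] is [1] and [azb_uniq] identifies
   [vb w] with [d], an element of the parabolic subgroup. *)
apply: (Rtilde_eq0 hH hR); rewrite -[iota (va w) * _]mulg1 -(iota1 hhat).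
move=> /(phi_below hS wS hhat r_inj rS (vIP w) (vaP w)).
move=> [v' [d [e [[E IJ dJ _ e1] [_ bE]]]]]; apply: nP.
have {}e1 : e = 1.
  by apply/eqP; rewrite -(len_eq0 hS) -leqn0 -(len1 S) bruhat_leq.
move: E; rewrite (phi_triple hhat r (erefl (vI v')) (erefl (va v')) bE) e1 mulg1.
move=> /(azb_uniq hS hhat r_inj rS (vIP v) (vIP v') (vaP v) (vaP v'))[-> _ ->].
by rewrite IJ dJ.
Qed.

Variable b : V S -> V S -> laurent.
Hypothesis hb : is_springer_matrix act RW b.

Lemma actK s v : s \in S -> act (1%g, s) (act (1%g, s) v) = v.
Proof.
move=> sS; rewrite -(VactM hact).
have -> : (1, s) * (1, s) = 1 :> W * W.
  transitivity (1 * 1 : W, s * s) => //.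
  by rewrite mul1g (cox_invol hS).
exact: (Vact1 hact).
Qed.

(** Springer's condition is applied to the basis vector at [v]. As [(1, s)] raises the dimension of
    [v], [T] sends it to a single basis vector, and the coefficients at [w] are compared. *)
Lemma springer_rec s w v : s \in S -> (Vdim v < Vdim (act (1%g, s) v))%R ->
  (b w (act (1%g, s) v) = b (act (1%g, s) w) v +
   (if (Vdim (act (1%g, s) w) < Vdim w)%R then 0 else beta * b w v))%R.
Proof.
move=> sS lt; pose f (x : V S) : laurent := (x == v)%:R%R.
have semil x : semilinear_map b f x = b x v.
  rewrite /semilinear_map (bigD1 v) //= /f eqxx rmorph1 mul1r big1 ?addr0 // => y.
  by move=> /negPf->; rewrite rmorph0 mul0r.
have s1 : bold_gen S (1, s) by rewrite /bold_gen /= eqxx sS orbT.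
have := springer_T hb f w s1.
rewrite /V_Tinv /Tinv /Tact !semil /semilinear_map.
rewrite (bigD1 (act (1%g, s) v)) //= big1 => [|y ny]; last first.
  rewrite /V_T /Tact /f.
  have /negPf-> : act (1%g, s) y != v by apply: contra ny => /eqP<-; rewrite actK.
  case: eqVneq => [->|_]; last by rewrite mulr0 if_same addr0 rmorph0 mul0r.
  by rewrite ltNge ltW //= addr0 rmorph0 mul0r.
rewrite addr0 /V_T /Tact /f actK // eqxx.
have /negPf-> : act (1%g, s) v != v.
  by apply: contraTneq lt => ->; rewrite ltxx.
rewrite mulr0 if_same addr0 rmorph1 mul1r => ->; rewrite -addrA; congr (_ + _)%R.
by case: ifP => _; rewrite ?subrr ?add0r // bar_alpha mulNr.
Qed.

Lemma longest_conj s : s \in S -> wS * s * wS \in S.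
Proof.
move=> sS; have E : (l (wS * s * wS) + l (wS * s))%N = l wS :=
  longest_lenl hS hwS _.
have E' : (l (wS * s) + l s)%N = l wS := longest_lenr hS hwS _.
have ls := len_gen hS sS.
have l1 : l (wS * s * wS) = 1%N by lia.
have [w [wwS lw] wE] := reduced_exists hS (wS * s * wS).
move: lw wwS; rewrite -wE l1; case: w wE => [|t [|]] //= wE _ /andP[tS _].
by rewrite wE big_seq1.
Qed.

Lemma springer_Rtilde w v : b w v = rho (phi' v) (phi' w).
Proof.
have [u ru] := reduced_exists hS (vb v).
elim: u ru v w => [|s u IHu] ru v w vE.
  have v1 : vb v = 1 by rewrite vE big_nil.
  by rewrite (springer_base hb) // Rtilde_phi_base.
have [sS ru' lt] := reduced_cons hS ru.
set v0 := act (1%g, s) v; have v0K : act (1%g, s) v0 = v by rewrite actK.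
have [EI Ea Eb] : [/\ vI v0 = vI v, va v0 = va v & vb v0 = s * vb v].
  by have := Vact_right hact v sS; rewrite /v0 /vI /va /vb => ->.
have v0E : vb v0 = wprod u by rewrite Eb vE big_cons (coxKl hS).
have {}IHu x := IHu ru' v0 x v0E.
have ltv : (Vdim v0 < Vdim (act (1%g, s) v0))%R.
  rewrite v0K /Vdim EI Ea ltrD2r ltrD2l v0E vE big_cons ltz_nat.
  exact: lt.
rewrite -{1}v0K springer_rec // !IHu.
set t := iota (wS * s * wS).
have tH : t \in Shat by apply/(hat_iotaS hhat)/longest_conj.
have actE x : phi' (act (1%g, s) x) = phi' x * t :=
  phi_act_right hS hwS hhat r hact x sS.
(* Length and dimension enter [phi_len] with opposite signs, so descents in [V] become ascents in
   [What]. *)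
have ltE x :
  (Vdim (act (1%g, s) x) < Vdim x)%R = (lh (phi' x) < lh (phi' x * t))%N.
  rewrite -actE -ltz_nat !(phi_len hS hwS hhat r_inj rS).
  by rewrite !ltrD2r ltrN2.
have -> : phi' v0 = phi' v * t by rewrite -actE.
have ltx : (lh (phi' v) < lh (phi' v * t))%N by move: ltv; rewrite v0K /v0 ltE.
rewrite actE ltE; case: ifP => [lty|/negbT].
  by rewrite addr0 (Rtilde_rr hH hR).
rewrite (lenSr hH _ tH) negbK => lty.
have yE : phi' w = phi' w * t * t by rewrite (coxKr hH).
have lty' : (lh (phi' w * t) < lh (phi' w * t * t))%N by rewrite -yE.
(* The leading terms of both recursions agree already; the [beta] terms agree once the final [t] is
   stripped from both elements. *)
rewrite [in RHS]yE (Rtilde_r hH hR _ tH lty') ltx.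
by rewrite [in LHS]yE (Rtilde_rr hH hR tH ltx lty') -yE.
Qed.

End Springer.

Local Open Scope ring_scope.

(** * Kazhdan-Lusztig polynomials *)

Section Kernel.

Variable T : finType.

(** Passing to square matrices makes a one-sided inverse two-sided, by [mulmx1C]. *)
Definition kernel_mx (K : Type) (f : T -> T -> K) : 'M[K]_#|T| :=
  \matrix_(i, j) f (enum_val i) (enum_val j).

Lemma kernel_mxM (K : comNzRingType) (f g : T -> T -> K) :
  kernel_mx f *m kernel_mx g =
  kernel_mx (fun x y => \sum_z f x z * g z y).
Proof.
apply/matrixP=> i j; rewrite !mxE.
rewrite (big_enum_val (A := T) (fun z => f (enum_val i) z * g z (enum_val j))).
by apply: eq_bigr => k _; rewrite !mxE.
Qed.

Lemma kernel_mx1 (K : comNzRingType) :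
  kernel_mx (fun x y => (x == y)%:R) = 1%:M :> 'M[K]_#|T|.
Proof. by apply/matrixP=> i j; rewrite !mxE (inj_eq enum_val_inj). Qed.

Lemma kernel_mxP (K : Type) (f g : T -> T -> K) :
  kernel_mx f = kernel_mx g <-> f =2 g.
Proof.
split=> [/matrixP E x y|E]; last by apply/matrixP=> i j; rewrite !mxE E.
by have := E (enum_rank x) (enum_rank y); rewrite !mxE !enum_rankK.
Qed.

Lemma kernel_invC (K : comUnitRingType) (f g : T -> T -> K) :
  (forall x y, \sum_z f x z * g z y = (x == y)%:R) ->
  forall x y, \sum_z g x z * f z y = (x == y)%:R.
Proof.
move=> fg; apply/kernel_mxP; rewrite -kernel_mxM kernel_mx1.
by apply: mulmx1C; rewrite kernel_mxM -kernel_mx1; apply/kernel_mxP.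
Qed.

Lemma kernel_left_inv (K : comUnitRingType) (f g h : T -> T -> K) :
  (forall x y, \sum_z f x z * g z y = (x == y)%:R) ->
  (forall x y, \sum_z h x z * g z y = (x == y)%:R) -> f =2 h.
Proof.
move=> fg hg; apply/kernel_mxP.
have {}fg : kernel_mx f *m kernel_mx g = 1%:M.
  by rewrite kernel_mxM -kernel_mx1; apply/kernel_mxP.
have {}hg : kernel_mx h *m kernel_mx g = 1%:M.
  by rewrite kernel_mxM -kernel_mx1; apply/kernel_mxP.
by rewrite -[LHS]mulmx1 -(mulmx1C hg) mulmxA fg mul1mx.
Qed.

Lemma kernel_assoc (K : comNzRingType) (f g h : T -> T -> K) x y :
  \sum_z (\sum_t f x t * g t z) * h z y = \sum_t f x t * (\sum_z g t z * h z y).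
Proof.
under eq_bigr do rewrite mulr_suml; rewrite exchange_big.
by apply: eq_bigr => t _; rewrite mulr_sumr; apply: eq_bigr => z _; rewrite mulrA.
Qed.

(* As matrices, p-bar = r-bar p, so that r-bar times the inverse of p is the
   inverse of p-bar; conjugating by the sign matrix turns r-bar into r and the
   inverse of p into q. *)
Lemma kernel_inverse_bar (sg : T -> bool) (p q r : T -> T -> laurent) :
  (forall x y, p x y = \sum_z r x z * bar (p z y)) ->
  (forall x y, bar (r x y) = (-1) ^+ (sg x (+) sg y) * r x y) ->
  (forall x y, \sum_z p x z * ((-1) ^+ (sg z (+) sg y) * q z y) = (x == y)%:R) ->
  forall x y, q x y = \sum_z bar (q x z) * r z y.
Proof.
move=> pE rbar pq.
pose B x y := (-1) ^+ (sg x (+) sg y) * q x y.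
have Bp := kernel_invC pq.
have Bp' x y : \sum_z bar (B x z) * bar (p z y) = (x == y)%:R.
  rewrite -[RHS](rmorph_nat bar) -Bp rmorph_sum /=.
  by apply: eq_bigr => z _; exact: (esym (rmorphM bar _ _)).
have p'E x y : bar (p x y) = \sum_z bar (r x z) * p z y.
  rewrite pE rmorph_sum; apply: eq_bigr => z _ /=.
  by rewrite rmorphM /= barK.
have BE : B =2 fun x y => \sum_z bar (B x z) * bar (r z y).
  apply: (kernel_left_inv (g := p)) => x y; first exact: Bp.
  pose bb f (x y : T) : laurent := bar (f x y).
  apply: etrans (kernel_assoc (bb B) (bb r) p x y) _.
  by rewrite -Bp'; apply: eq_bigr => z _; rewrite p'E.
move=> x y; have := BE x y; rewrite /B => /(congr1 (fun c =>
  (-1) ^+ (sg x (+) sg y) * c)).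
rewrite mulrA -signr_addb addbb expr0 mul1r => ->.
rewrite mulr_sumr; apply: eq_bigr => z _.
rewrite rbar rmorphM rmorph_sign /=.
set s1 := _ ^+ _; set s2 := _ ^+ _; set s3 := _ ^+ _.
have -> : s1 * (s2 * bar (q x z) * (s3 * r z y)) =
    s1 * s2 * s3 * (bar (q x z) * r z y) by ring.
rewrite /s1 /s2 /s3 -!signr_addb.
have -> : sg x (+) sg y (+) (sg x (+) sg z) (+) (sg z (+) sg y) = false.
  by case: (sg x); case: (sg y); case: (sg z).
by rewrite mul1r.
Qed.

End Kernel.

(** * Laurent polynomials with only negative powers of [u] *)

Section NegativePart.

Definition neg_laurent (x : laurent) := exists p :
  {poly int}, x = u^-1 * peval u^-1 p.

Lemma neg_laurent0 : neg_laurent 0.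
Proof. by exists 0; rewrite (rmorph0 (peval _)) mulr0. Qed.

Lemma neg_laurentD x y : neg_laurent x -> neg_laurent y -> neg_laurent (x + y).
Proof. by move=> [p ->] [q ->]; exists (p + q); rewrite pevalD mulrDr. Qed.

Lemma neg_laurentM x y : neg_laurent x -> neg_laurent y -> neg_laurent (x * y).
Proof.
move=> [p ->] [q ->]; exists (p * ('X * q)).
by rewrite !pevalM pevalX !mulrA.
Qed.

Lemma neg_laurentZ (c : int) x : neg_laurent x -> neg_laurent (c%:~R * x).
Proof. by move=> [p ->]; exists (c%:P * p); rewrite pevalM pevalC mulrCA. Qed.

Lemma neg_laurentN x : neg_laurent x -> neg_laurent (- x).
Proof. by move=> /(@neg_laurentZ (-1)); rewrite mulN1r. Qed.

Lemma neg_laurent_sum (I : Type) (r : seq I) (P : pred I) F :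
  (forall i, P i -> neg_laurent (F i)) -> neg_laurent (\sum_(i <- r | P i) F i).
Proof.
by move=> H; elim/big_ind: _ => //; [apply: neg_laurent0 | apply: neg_laurentD].
Qed.

Lemma neg_laurent_exp (k : int) : k < 0 -> neg_laurent (u ^ k).
Proof.
case: k => // k _; exists 'X^k; rewrite pevalXn NegzE -exprnN.
by rewrite -exprVn exprS.
Qed.

Lemma peval_sum x (p : {poly int}) :
  peval x p = \sum_(i < size p) (p`_i)%:~R * x ^+ i.
Proof.
rewrite /peval (horner_coef_wide (n := size p)); last exact: size_poly.
by apply: eq_bigr => i _; rewrite coef_map.
Qed.

Lemma neg_laurent_klnorm (k : int) (p : {poly int}) :
  k + ((size p).-1).*2%:Z < 0 -> neg_laurent (u ^ k * peval (u ^+ 2) p).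
Proof.
move=> lt; rewrite peval_sum mulr_sumr; apply: neg_laurent_sum => i _.
rewrite mulrCA; apply: neg_laurentZ; rewrite -exprM (exprnP u) -exprzDr
  ?u_unit //.
by apply: neg_laurent_exp; have := ltn_ord i; lia.
Qed.

(** [bar] turns the negative powers of [u] into positive ones, so a fixed element contains
    neither. *)
Lemma neg_laurent_bar x : neg_laurent x -> bar x = x -> x = 0.
Proof.
have buV : bar u^-1 = u by rewrite -bar_u barK.
move=> [p ->]; rewrite rmorphM /= buV.
have -> : bar (peval u^-1 p) = peval u p.
  rewrite !peval_sum rmorph_sum; apply: eq_bigr => i _ /=.
  by rewrite rmorphM rmorphXn /= rmorph_int buV.
have [->|p0 E] := eqVneq p 0; first by rewrite !rmorph0 mulr0.
exfalso; pose N := size p.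
(* Multiplying [u * p(u) = u^-1 * p(u^-1)] by [u ^+ N] clears denominators. The left side then has
   size [N + N.+1], the right side at most [N]. *)
have : 'X^(N.+1) * p = \sum_(i < N) (p`_i)%:P * 'X^(N - i.+1).
  apply: peval_u_inj; rewrite pevalM pevalXn exprSr -mulrA E peval_sum.
  rewrite rmorph_sum !mulr_sumr; apply: eq_bigr => i _.
  have uE : u ^+ N = u ^+ (N - i.+1) * u ^+ i * u.
    by rewrite -mulrA -exprSr -exprD subnK // ltn_ord.
  rewrite [RHS]pevalM pevalC pevalXn uE.
  rewrite [in LHS]mulrA mulrK ?u_unit // mulrCA; congr (_ * _).
  by rewrite exprVn mulrK // unitrX ?u_unit.
move/(congr1 (fun q : {poly int} => size q)); rewrite mulrC size_mulXn //.
apply/eqP; rewrite neq_ltn; apply/orP; right.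
apply: (@leq_ltn_trans N); last by rewrite addSn ltnS leq_addl.
apply: (leq_trans (size_sum _ _ _)); apply/bigmax_leqP => i _.
rewrite mul_polyC (leq_trans (size_scale_leq _ _)) // size_polyXn.
by have := ltn_ord i; lia.
Qed.

End NegativePart.

(** * Kazhdan-Lusztig matrices on a finite lower set *)

Section KLTransport.

Import classical_sets fsbigop.

Variables (G : groupType) (S : {pred G}).
Hypothesis hS : coxeter_system S.
Variables R P Q : G -> G -> {poly int}.
Hypothesis hR : is_R_polynomials S R.
Hypothesis hP : is_KL_polynomials S R P.
Hypothesis hQ : is_inverse_KL_polynomials S P Q.
Variables (T : finType) (phi : T -> G).
Hypothesis phi_inj : injective phi.
Hypothesis phi_lower : forall x v, bruhat S x (phi v) -> exists v', x = phi v'.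

Local Notation l := (cox_length S).
Local Notation rho := (Rtilde S R).
Local Notation le x y := (bruhat S (phi x) (phi y)).
Local Notation sg x y := (odd (l (phi x)) (+) odd (l (phi y))).

(** The interval lies in the image of [phi] by [phi_lower], so the finitely supported sum over the
    group can be indexed by [T]; the hypothesis on [F] removes the points outside the interval. *)
Lemma interval_sum (K : nmodType) (F : G -> K) x y :
  (forall z, ~ (le x z /\ le z y) -> F (phi z) = 0) ->
  \sum_(z \in bruhat_interval S (phi x) (phi y)) F z = \sum_z F (phi z).
Proof.
move=> F0; pose D z := boolp.asbool (bruhat_interval S (phi x) (phi y) z).
have -> : bruhat_interval S (phi x) (phi y) = [set` D]%classic.
  by apply/boolp.funext => z; rewrite /= /D boolp.asboolE.
rewrite -(@bigfs _ _ _ _ (map phi (index_enum T))).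
- rewrite big_map big_mkcond; apply: eq_bigr => z _; rewrite /D.
  by case: boolp.asboolP => // /F0.
- by rewrite map_inj_uniq // index_enum_uniq.
move=> z /boolp.asboolP[_ /phi_lower[v ->]].
by rewrite map_f // mem_index_enum.
Qed.

Lemma KL_inverse x y :
  \sum_z P (phi x) (phi z) * ((-1) ^+ sg z y * Q (phi z) (phi y)) = (x == y)%:R.
Proof.
have PQ z :
  (-1) ^+ (l (phi z) - l (phi x))%N * (P (phi x) (phi z) * Q (phi z) (phi y)) =
    (-1) ^+ sg x y * (P (phi x) (phi z) * ((-1) ^+ sg z y * Q (phi z) (phi y))).
  (* The truncated difference of lengths has the right parity when [phi x] is below [phi z];
     otherwise [P] vanishes. *)
  have [xz|/(klP_le hP) ->] := boolp.pselect (le x z); last by rewrite !mul0r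
    !mulr0.
  rewrite [P _ _ * (_ * _)]mulrCA [RHS]mulrA -signr_addb -signr_odd.
  rewrite oddB ?bruhat_leq //; congr (_ ^+ _ * _).
  by case: odd; case: odd; case: odd.
have := klQ_inv hQ (phi x) (phi y); rewrite interval_sum; last first.
  move=> z nz; have [xz|/(klP_le hP) ->] := boolp.pselect (le x z).
    rewrite (klQ_le hQ) ?mulr0 // => zy; exact: nz.
  by rewrite mul0r mulr0.
under eq_bigr do rewrite PQ.
rewrite -mulr_sumr (inj_eq phi_inj) => /(congr1 (fun c => (-1) ^+ sg x y * c)).
rewrite signrMK => ->.
by case: eqVneq => [->|_]; rewrite ?mulr0 // addbb mul1r.
Qed.

Lemma klnormM F H x y z (s : bool) :
  klnorm S F x z * ((-1) ^+ s * klnorm S H z y) =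
  u ^ ((l x)%:Z - (l y)%:Z) * peval (u ^+ 2) (F x z * ((-1) ^+ s * H z y)).
Proof.
rewrite !pevalM (rmorph_sign (peval _)) /klnorm.
have -> : (l x)%:Z - (l y)%:Z = ((l x)%:Z - (l z)%:Z) + ((l z)%:Z - (l y)%:Z) by ring.
by rewrite [in RHS]exprzDr ?u_unit // [(-1) ^+ s * _]mulrCA mulrACA.
Qed.

Local Notation p x y := (klnorm S P (phi x) (phi y)).
Local Notation q x y := (klnorm S Q (phi x) (phi y)).

Lemma klnorm_inverse x y :
  \sum_z p x z * ((-1) ^+ sg z y * q z y) = (x == y)%:R.
Proof.
under eq_bigr do rewrite klnormM.
rewrite -mulr_sumr -rmorph_sum /= KL_inverse (rmorph_nat (peval _)).
by case: eqVneq => [->|_]; rewrite ?mulr0 // subrr expr0z mulr1.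
Qed.

Lemma klnorm_bar x y : p x y = \sum_z rho (phi x) (phi z) * bar (p z y).
Proof.
rewrite (klP_bar hP) (@interval_sum _ (fun z => bar (klnorm S P z (phi y)) * _)).
  by apply: eq_bigr => z _; rewrite (bar_klnorm hS hR) mulrC.
move=> z nz; rewrite (bar_klnorm hS hR).
have [xz|/(Rtilde_eq0 hS hR) ->] := boolp.pselect (le x z); last by rewrite mulr0.
rewrite /klnorm (klP_le hP);
  first by rewrite (rmorph0 (peval _)) mulr0 rmorph0 mul0r.
by move=> zy; apply: nz.
Qed.

Lemma klnorm_inv_bar x y : q x y = \sum_z bar (q x z) * rho (phi z) (phi y).
Proof.
apply: (@kernel_inverse_bar T (fun x => odd (l (phi x)))
  (fun x y => p x y) (fun x y => q x y) (fun x y => rho (phi x) (phi y))).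
- exact: klnorm_bar.
- by move=> v w; rewrite (bar_Rtilde hS hR) -signr_odd oddD.
- exact: klnorm_inverse.
Qed.

Lemma klnorm_neq0 F x y : (forall x y, ~ bruhat S x y -> F x y = 0) ->
  klnorm S F x y != 0 -> bruhat S x y.
Proof.
move=> F0 /eqP nz; apply: boolp.contrapT => /F0 E; apply: nz.
by rewrite /klnorm E (rmorph0 (peval _)) mulr0.
Qed.

Lemma klP_diag_norm x : klnorm S P x x = 1.
Proof. by rewrite /klnorm (klP_diag hP) (rmorph1 (peval _)) subrr expr0z mulr1. Qed.

Lemma klP_neg x y : x != y -> neg_laurent (klnorm S P x y).
Proof.
move=> xy; have [le|/(klP_le hP) E] := boolp.pselect (bruhat S x y); last first.
  by rewrite /klnorm E (rmorph0 (peval _)) mulr0; apply: neg_laurent0.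
by apply: neg_laurent_klnorm; have := klP_deg hP le xy; lia.
Qed.

Lemma klQ_diag_norm x : q x x = 1.
Proof.
have := klnorm_inverse x x; rewrite eqxx (bigD1 x) //= big1 => [|z zx].
  by rewrite addr0 klP_diag_norm addbb !mul1r.
have [->|/(klnorm_neq0 (klP_le hP)) xz] := eqVneq (p x z) 0;
  first by rewrite mul0r.
have [->|/(klnorm_neq0 (klQ_le hQ)) zx'] := eqVneq (q z x) 0; first by rewrite
  !mulr0.
by move: zx; rewrite -(inj_eq phi_inj) (bruhat_anti zx' xz) eqxx.
Qed.

Lemma neg_laurent_sign (s : bool) a : neg_laurent a ->
  neg_laurent ((-1) ^+ s * a).
Proof. by move=> na; case: s; rewrite ?mulN1r ?mul1r //; apply: neg_laurentN. Qed.

(** The inverse relation is solved for [q x y]. Every remaining term has a factor [p x z] with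
    [z != x], which is negative, and a factor [q z y] that is [1] or negative by induction on the
    length difference. *)
Lemma klQ_neg x y : x != y -> neg_laurent (q x y).
Proof.
have [k] := ubnP (l (phi y) - l (phi x))%N; elim: k x => // k IHk x lek xy.
have := klnorm_inverse x y; rewrite (negPf xy) (bigD1 x) //= klP_diag_norm mul1r.
move/eqP; rewrite addr_eq0 => /eqP/(congr1 (fun c => (-1) ^+ sg x y * c)).
rewrite signrMK mulrN => ->; apply/neg_laurentN/neg_laurent_sign.
apply: neg_laurent_sum => z zx.
have [->|/(klnorm_neq0 (klP_le hP)) xz] := eqVneq (p x z) 0.
  by rewrite mul0r; apply: neg_laurent0.
have nxz : neg_laurent (p x z) by apply: klP_neg; rewrite (inj_eq phi_inj) eq_sym.
have [<-|zy] := eqVneq z y.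
  by rewrite klQ_diag_norm addbb !mulr1.
apply: neg_laurentM => //; apply: neg_laurent_sign.
have [->|/(klnorm_neq0 (klQ_le hQ)) zy'] := eqVneq (q z y) 0;
  first exact: neg_laurent0.
apply: IHk => //.
have [lxz|/phi_inj xz'] := bruhat_len xz; last by rewrite xz' eqxx in zx.
have [lzy|/phi_inj zy1] := bruhat_len zy'; last by rewrite zy1 eqxx in zy.
by move: lek; lia.
Qed.

(** By induction on the length of [phi y], all terms with [z] strictly below [y] cancel in the
    difference of the two expansions. What is left is fixed by [bar], because [Rtilde] is [1] on the
    diagonal, and negative, hence zero. *)
Lemma bar_kernel_uniq (g h : T -> T -> laurent) :
  (forall x, g x x = 1) -> (forall x, h x x = 1) ->
  (forall x y, x != y -> neg_laurent (g x y)) ->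
  (forall x y, x != y -> neg_laurent (h x y)) ->
  (forall x y, g x y = \sum_z bar (g x z) * rho (phi z) (phi y)) ->
  (forall x y, h x y = \sum_z bar (h x z) * rho (phi z) (phi y)) ->
  g =2 h.
Proof.
move=> g1 h1 gneg hneg gE hE x y; apply/eqP; rewrite -subr_eq0; apply/eqP.
have [k] := ubnP (l (phi y)); elim: k y => // k IHk y lek.
have [<-|xy] := eqVneq x y; first by rewrite g1 h1 subrr.
apply: neg_laurent_bar; first by apply: neg_laurentD;
  [exact: gneg|apply/neg_laurentN/hneg].
rewrite [in RHS]gE [in RHS]hE -sumrB (bigD1 y) //= big1 => [|z zy].
  by rewrite addr0 (Rtilde_diag hS hR) !mulr1 rmorphB.
rewrite -mulrBl -rmorphB.
have [zy'|/(Rtilde_eq0 hS hR) ->] := boolp.pselect (le z y);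
  last by rewrite mulr0.
have [lt|/phi_inj E] := bruhat_len zy'; last by rewrite E eqxx in zy.
by rewrite IHk ?rmorph0 ?mul0r // (leq_trans lt).
Qed.

End KLTransport.

Lemma peval_sqr_inj : injective (peval (u ^+ 2)).
Proof.
move=> a b E; apply/eqP; rewrite -subr_eq0.
have c2 (c : {poly int}) : peval (u ^+ 2) c = peval u (c \Po 'X^2).
  elim/poly_ind: c => [|c d IH]; first by rewrite comp_poly0 !rmorph0.
  rewrite comp_polyD comp_polyM comp_polyX comp_polyC !pevalD !pevalM IH.
  by rewrite !pevalX !pevalC.
rewrite -(@comp_poly_eq0 _ _ 'X^2) ?size_polyXn //; apply/eqP.
by apply: peval_u_inj; rewrite -c2 pevalB E subrr rmorph0.
Qed.

Theorem corollary2p9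
    (W : finGroupType) (S : {set W}) (hS : coxeter_system S)
    (wS : W) (hwS : forall x : W, (cox_length S x <= cox_length S wS)%N)
    (What : groupType) (Shat : {pred What}) (iota theta : W -> What)
    (hhat : is_hat_system S Shat iota theta)
    (n : nat) (r : 'I_n -> W) (r_inj : injective r)
    (rS : forall s : W, s \in S <-> exists i : 'I_n, s = r i)
    (act : W * W -> V S -> V S) (hact : is_Vaction act)
    (RW : W -> W -> {poly int}) (hRW : is_R_polynomials S RW)
    (b : V S -> V S -> laurent) (hb : is_springer_matrix act RW b)
    (c : V S -> V S -> {poly int}) (hc : is_V_KL_polynomials b c)
    (cinv : V S -> V S -> {poly int})
    (hcinv : is_V_inverse_KL_polynomials c cinv)
    (R : What -> What -> {poly int}) (hR : is_R_polynomials Shat R)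
    (P : What -> What -> {poly int}) (hP : is_KL_polynomials Shat R P)
    (Q : What -> What -> {poly int}) (hQ : is_inverse_KL_polynomials Shat P Q) :
  let phi' : V S -> What := phi iota theta r wS in
  let x0 : What := (iota wS * hat_z theta r set0 * iota wS)%g in
  [/\ injective phi',
      forall x : What, bruhat Shat x x0 <-> exists v : V S, x = phi' v &
      forall v w : V S, Vle v w <-> bruhat Shat (phi' w) (phi' v)] /\
  (forall v : V S, (cox_length Shat (phi' v))%:Z =
     - Vdim v + #|S|%:Z + (cox_length S wS)%:Z) /\
  (forall (x y : W) (v : V S),
     phi' (act (x, y) v) =
     (iota x * phi' v * iota wS * (iota y)^-1 * iota wS)%g) /\
  (forall v w : V S, b w v = Rtilde Shat R (phi' v) (phi' w)) /\
  (forall v w : V S, c w v = Q (phi' v) (phi' w)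
                     /\ cinv w v = P (phi' v) (phi' w)).
Proof.
move=> phi' x0.
have hH := hat_coxeter hhat.
have phiI : injective phi' := phi_inj hS hhat r_inj rS.
have phiB x : bruhat Shat x x0 <-> exists v, x = phi' v.
  exact: (phi_interval hS hwS hhat r_inj rS).
have phiL v w : Vle v w <-> bruhat Shat (phi' w) (phi' v).
  split; first exact: (Vle_phi hS hwS hhat r_inj rS).
  exact: (phi_Vle hS hwS hhat r_inj rS).
have phi_l v : (cox_length Shat (phi' v))%:Z =
     - Vdim v + #|S|%:Z + (cox_length S wS)%:Z.
  exact: (phi_len hS hwS hhat r_inj rS).
have bE v w : b w v = Rtilde Shat R (phi' v) (phi' w).
  exact: (springer_Rtilde hS hwS hhat r_inj rS hact hRW hR hb).
have lower x v : bruhat Shat x (phi' v) -> exists v', x = phi' v'.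
  move=> xv; apply/phiB; apply: bruhat_trans xv _.
  by apply/phiB; exists v.
have dimE v w : (cox_length Shat (phi' v))%:Z - (cox_length Shat (phi' w))%:Z =
    Vdim w - Vdim v.
  by rewrite !phi_l; ring.
have cQ v w : c w v = Q (phi' v) (phi' w).
  (* The indices are exchanged because [phi'] reverses the order; [VKL_bar] then reads as
     multiplication by [Rtilde] on the right, just as in [klnorm_inv_bar]. *)
  have gE : (fun v w => Vgamma c w v) =2
      (fun v w => klnorm Shat Q (phi' v) (phi' w)).
    apply: (bar_kernel_uniq hH hR phiI) => [x|x|x y xy|x y xy|x y|x y].
    - exact: (VKL_diag hc).
    - exact: (klQ_diag_norm hP hQ phiI lower).
    - have [yx|/(VKL_le hc) E] := boolp.pselect (Vle y x).
        by apply: (VKL_deg hc) => //; rewrite eq_sym.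
      by rewrite /Vgamma E (rmorph0 (peval _)) mulr0; apply: neg_laurent0.
    - exact: (klQ_neg hP hQ phiI lower).
    - rewrite (VKL_bar hc) big_mkcond; apply: eq_bigr => z _ /=.
      rewrite bE mulrC /Vinterval; case: boolp.asboolP => // nz.
      have [yz|nyz] := boolp.pselect (Vle y z); last first.
        by rewrite (Rtilde_eq0 hH hR) ?mulr0 // => /phiL.
      rewrite /Vgamma (VKL_le hc);
        first by rewrite (rmorph0 (peval _)) mulr0 rmorph0 mul0r.
      by move=> zx; apply: nz.
    - exact: (klnorm_inv_bar hH hR hP hQ phiI lower).
  have := gE v w; rewrite /Vgamma /klnorm dimE.
  move/(mulrI (unitrXz _ u_unit)) => /peval_sqr_inj; exact.
split; first by split.
split; first exact: phi_l.
split; first exact: (phi_act hS hwS hhat rS hact).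
split; first exact: bE.
move=> v w; split=> //.
pose sg x y := odd (cox_length Shat (phi' x)) (+) odd (cox_length Shat (phi' y)).
have PQ := KL_inverse hP hQ phiI lower.
(* [P] and the transpose of [cinv] are both left inverses of the sign-twisted [Q]. *)
suff cinvQ x y : \sum_z cinv z x * ((-1) ^+ sg z y * Q (phi' z) (phi' y)) =
    (x == y)%:R.
  exact: (kernel_left_inv (f := fun v w => cinv w v) cinvQ PQ v w).
move: x y => {}v {}w.
have := VKLinv_inv hcinv w v; rewrite eq_sym => <-.
rewrite [RHS]big_mkcond; apply: eq_bigr => z _ /=.
rewrite /Vinterval; case: boolp.asboolP => [[wz zv]|nz].
  rewrite cQ mulrC -mulrA; congr (_ * _).
  have le : bruhat Shat (phi' z) (phi' w) by apply/phiL.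
  rewrite -dimE subzn ?bruhat_leq // -exprnP -[RHS]signr_odd oddB ?bruhat_leq //.
  by rewrite /sg addbC.
have [zv|/(VKLinv_le hcinv) ->] := boolp.pselect (Vle z v); last by rewrite mul0r.
rewrite (klQ_le hQ) ?mulr0 // => /phiL wz; exact: nz.
Qed.
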